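(* Let $n\ge 2$, and let $E=\{e_r:1\le r\le n\}$ and $T=\{t_{ij}:1\le i<j\le n\}$ be alphabets, with the symmetric notation $t_{ji}=t_{ij}$. Let $\phi:(E\cup T)^+\to\mathcal P_n\setminus\mathcal S_n$ be the semigroup homomorphism determined by $e_r\phi=\overline e_r$ and $t_{ij}\phi=\overline t_{ij}$. Then the semigroup $\mathcal P_n\setminus\mathcal S_n$ has semigroup presentation $\langle E\cup T : R\rangle$ via $\phi$ (that is, $\phi$ is surjective and its kernel is the congruence on $(E\cup T)^+$ generated by $R$), where $R$ consists of the following relations, in which $i,j,k,l$ range over $\{1,\dots,n\}$ and the two subscripts of any letter $t_{ij}$ are always distinct: \begin{itemize} \item[(R1)] $e_i^2=e_i$ for all $i$; \item[(R2)] $e_ie_j=e_je_i$ for distinct $i,j$; \item[(R3)] $t_{ij}^2=t_{ij}$ for all $i,j$; \item[(R4)] $t_{ij}t_{kl}=t_{kl}t_{ij}$ for all $i,j,k,l$; \item[(R5)] $t_{ij}t_{jk}=t_{jk}t_{ki}$ for distinct $i,j,k$; \item[(R6)] $t_{ij}e_k=e_kt_{ij}$ if $k\notin\{i,j\}$; \item[(R7)] $t_{ij}e_kt_{ij}=t_{ij}$ if $k\in\{i,j\}$; \item[(R8)] $e_kt_{ij}e_k=e_k$ if $k\in\{i,j\}$; \item[(R9)] $e_kt_{ki}e_it_{ij}e_jt_{jk}e_k=e_kt_{kj}e_jt_{ji}e_it_{ik}e_k$ for distinct $i,j,k$; \item[(R10)] $e_kt_{ki}e_it_{ij}e_jt_{jl}e_lt_{lk}e_k=e_kt_{kl}e_lt_{li}e_it_{ij}e_jt_{jk}e_k$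 for distinct $i,j,k,l$. \end{itemize}
   Context: Write $\mathbf n=\{1,\dots,n\}$ and $\mathbf n'=\{1',\dots,n'\}$. The partition monoid $\mathcal P_n$ is the set of all set partitions of $\mathbf n\cup\mathbf n'$ with the following product. For $\alpha,\beta\in\mathcal P_n$, take a third copy $\mathbf n''=\{1'',\dots,n''\}$ of $\mathbf n$, replace each $x'$ by $x''$ in $\alpha$, and replace each $x$ by $x''$ in $\beta$ (for $x\in\mathbf n$). Form the finest equivalence relation on $\mathbf n\cup\mathbf n''\cup\mathbf n'$ under which any two elements in a common block of the modified $\alpha$ or in a common block of the modified $\beta$ are equivalent. Then $\alpha\beta$ is the partition of $\mathbf n\cup\mathbf n'$ obtained by restricting this equivalence to $\mathbf n\cup\mathbf n'$. The identity is the partition with blocks $\{x,x'\}$, $x\in\mathbf n$. A transversal block of $\alpha$ is a block meeting both $\mathbf n$ and $\mathbf n'$; $\operatorname{rank}(\alpha)$ is the number of transversal blocks. $\mathcal S_n\subseteq\mathcal P_n$ is the group of units, i.e. the set of partitions of rank $n$ (identified with the symmetric group), and $\mathcal P_n\setminus\mathcal S_n=\{\alpha\in\mathcal P_n:\operatorname{rank}(\alpha)<n\}$ is a subsemigroup (an ideal). For $1\le r\le n$, $\overline e_r$ is the partition with blocks $\{r\}$, $\{r'\}$ and $\{x,x'\}$ for $x\ne r$. For $i\neq j$, $\overline t_{ij}=\overline t_{ji}$ is the partition with blocks $\{i,j,i',j'\}$ and $\{x,x'\}$ for $x\notin\{i,j\}$. $X^+$ denotes the free semigroup on an alphabet $X$.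 The kernel of a homomorphism is the congruence consisting of pairs with equal image. Maps are written on the right. *)

(* Defs.v *)
From HB Require Import structures.
From mathcomp Require Import all_boot.

Set Implicit Arguments.
Unset Strict Implicit.
Unset Printing Implicit Defensive.

Local Open Scope group_scope.

Definition same_block (T : finType) (P : {set {set T}}) : rel T :=
  fun u v => [exists B in P, (u \in B) && (v \in B)].

Lemma same_blockP (T : finType) (P : {set {set T}}) (u v : T) :
  reflect (exists B, [/\ B \in P, u \in B & v \in B]) (same_block P u v).
Proof.
apply: (iffP existsP) => [[B /andP[PB /andP[uB vB]]]|[B [PB uB vB]]].
  by exists B.
by exists B; rewrite PB uB vB.
Qed.

Lemma same_block_sym (T : finType) (P : {set {set T}}) :
  symmetric (same_block P).
Proof.
by move=> u v; apply/same_blockP/same_blockP => -[B [*]]; exists B.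
Qed.

Lemma same_block_imP (S T : finType) (f : S -> T) (P : {set {set S}}) (u v : T) :
  reflect (exists p q, [/\ u = f p, v = f q & same_block P p q])
          (same_block [set f @: (A : {set S}) | A in P] u v).
Proof.
apply: (iffP (same_blockP _ _ _)).
  move=> [_ [/imsetP[A PA ->] /imsetP[p pA ->] /imsetP[q qA ->]]].
  by exists p, q; split=> //; apply/same_blockP; exists A.
move=> [p [q [-> -> /same_blockP[A [PA pA qA]]]]].
by exists (f @: A); split; apply: imset_f.
Qed.

Lemma same_blockU (T : finType) (P Q : {set {set T}}) (u v : T) :
  same_block (P :|: Q) u v = same_block P u v || same_block Q u v.
Proof.
apply/same_blockP/orP => [[B [/setUP[]]]|[]/same_blockP[B [PB uB vB]]].
- by move=> PB uB vB; left; apply/same_blockP; exists B.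
- by move=> PB uB vB; right; apply/same_blockP; exists B.
- by exists B; rewrite inE PB.
- by exists B; rewrite inE PB orbT.
Qed.

Lemma connect_same_block_sym (T : finType) (P : {set {set T}}) (u v : T) :
  connect (same_block P) u v = connect (same_block P) v u.
Proof. exact: (sym_connect_sym (@same_block_sym T P)). Qed.

Lemma connect_inv (T : finType) (e : rel T) (Q : T -> Prop) :
    (forall u v, e u v -> Q u -> Q v) ->
  forall u v, connect e u v -> Q u -> Q v.
Proof.
move=> Qe u v /connectP[s]; elim: s u => [|w s IHs] u /= => [_ -> //|].
by move=> /andP[uw ws] ev /(Qe _ _ uw); apply: (IHs w ws ev).
Qed.

Lemma partition_of (T : finType) (P : {set {set T}}) (f : T -> {set T}) :
    (forall B, B \in P -> B != set0) -> (forall p, f p \in P) ->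
    (forall p, p \in f p) -> (forall B p, B \in P -> p \in B -> B = f p) ->
  partition P [set: T].
Proof.
move=> P0 fP pf uniqf; apply/and3P; split.
- apply/eqP/setP => p; rewrite inE; apply/bigcupP.
  by exists (f p); [apply: fP | apply: pf].
- apply/trivIsetP => A B PA PB nAB; rewrite -setI_eq0.
  apply/eqP/setP => p; rewrite !inE; apply/negP => /andP[pA pB].
  by case/negP: nAB; rewrite (uniqf A p PA pA) (uniqf B p PB pB).
- by apply/negP => /P0; rewrite eqxx.
Qed.

(* [inl x] is the point x and [inr x] the point x'; the indices 1, ..., n are
   represented by the ordinals 0, ..., n - 1. *)
Definition vertex (n : nat) : finType := ('I_n + 'I_n)%type.

Record pmon (n : nat) := PMon {
  blocks :> {set {set vertex n}};
  blocks_partition : partition blocks [set: vertex n]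
}.

HB.instance Definition _ n := [isSub for @blocks n].
HB.instance Definition _ n := [Finite of pmon n by <:].

(* The disjoint union of the three copies: [inl p] is the point p of
   n u n', and [inr x] is x''. *)
Definition vertex3 (n : nat) : finType := (vertex n + 'I_n)%type.

Definition top_mid (n : nat) (p : vertex n) : vertex3 n :=
  match p with inl x => inl (inl x) | inr x => inr x end.

Definition mid_bot (n : nat) (p : vertex n) : vertex3 n :=
  match p with inl x => inr x | inr x => inl (inr x) end.

(* [connect] is the reflexive transitive closure, hence here the finest
   equivalence containing the (symmetric) relation [same_block _]. *)
Definition joined (n : nat) (a b : pmon n) : rel (vertex3 n) :=
  connect (same_block ([set @top_mid n @: (A : {set vertex n}) | A in blocks a]
                   :|: [set @mid_bot n @: (B : {set vertex n}) | B in blocks b])).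

Definition pmul_blocks (n : nat) (a b : pmon n) : {set {set vertex n}} :=
  equivalence_partition (fun p q => joined a b (inl p) (inl q)) [set: vertex n].

Lemma joined_sym (n : nat) (a b : pmon n) (u v : vertex3 n) :
  joined a b u v = joined a b v u.
Proof. exact: connect_same_block_sym. Qed.

Lemma joined_trans (n : nat) (a b : pmon n) : transitive (joined a b).
Proof. exact: connect_trans. Qed.

Lemma joined_equiv (n : nat) (a b : pmon n) :
  {in [set: vertex n] & &,
     equivalence_rel (fun p q => joined a b (inl p) (inl q))}.
Proof.
move=> p q r _ _ _; split; first exact: connect0.
move=> pq; apply/idP/idP; last exact: joined_trans.
by apply: joined_trans; rewrite joined_sym.
Qed.

Lemma pmul_partition (n : nat) (a b : pmon n) :
  partition (pmul_blocks a b) [set: vertex n].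
Proof. exact: equivalence_partitionP (@joined_equiv n a b). Qed.

Definition pmul (n : nat) (a b : pmon n) : pmon n :=
  PMon (pmul_partition a b).

Definition pone_blocks (n : nat) : {set {set vertex n}} :=
  [set [set inl x; inr x] | x : 'I_n].

Lemma pone_partition (n : nat) : partition (pone_blocks n) [set: vertex n].
Proof.
apply: (@partition_of _ _ (fun p =>
  match p with inl x | inr x => [set inl x; inr x] end)).
- by move=> _ /imsetP[x _ ->]; apply/set0Pn; exists (inl x); rewrite !inE eqxx.
- by case=> x; apply: imset_f.
- by case=> x; rewrite !inE eqxx ?orbT.
- by move=> _ p /imsetP[x _ ->]; rewrite !inE => /orP[]/eqP->.
Qed.

Definition pone (n : nat) : pmon n := PMon (pone_partition n).

Lemma same_block_pblock (n : nat) (a : pmon n) (p q : vertex n) :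
  same_block a p q = (q \in pblock a p).
Proof.
have /and3P[/eqP cov tri _] := blocks_partition a.
apply/same_blockP/idP => [[B [aB pB qB]]|qp].
  by rewrite (def_pblock tri aB pB).
exists (pblock a p); rewrite pblock_mem ?mem_pblock ?cov ?inE //.
Qed.

Lemma same_block_refl (n : nat) (a : pmon n) (p : vertex n) : same_block a p p.
Proof.
have /and3P[/eqP cov _ _] := blocks_partition a.
by rewrite same_block_pblock mem_pblock cov inE.
Qed.

Lemma same_block_trans (n : nat) (a : pmon n) : transitive (same_block a).
Proof.
move=> q p r /same_blockP[A [aA pA qA]] /same_blockP[B [aB qB rB]].
have /and3P[_ tri _] := blocks_partition a.
apply/same_blockP; exists A; split=> //.
by rewrite -(def_pblock tri aA qA) (def_pblock tri aB qB).
Qed.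

Lemma pmon_ext (n : nat) (a b : pmon n) :
  same_block a =2 same_block b -> a = b.
Proof.
move=> eab; apply: val_inj => /=.
rewrite -(equivalence_partition_pblock (blocks_partition a)).
rewrite -(equivalence_partition_pblock (blocks_partition b)).
apply: eq_imset => p; apply/setP => q.
by rewrite !inE -!same_block_pblock eab.
Qed.

Lemma same_block_mul (n : nat) (a b : pmon n) (p q : vertex n) :
  same_block (pmul a b) p q = joined a b (inl p) (inl q).
Proof.
rewrite same_block_pblock /= /pmul_blocks.
by rewrite (pblock_equivalence_partition (@joined_equiv n a b)) ?inE.
Qed.

Lemma joined_ind (n : nat) (a b : pmon n) (Q : vertex3 n -> Prop) :
    (forall p q, same_block a p q -> Q (top_mid p) -> Q (top_mid q)) ->
    (forall p q, same_block b p q -> Q (mid_bot p) -> Q (mid_bot q)) ->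
  forall u v, joined a b u v -> Q u -> Q v.
Proof.
move=> Qa Qb; apply: connect_inv => u v; rewrite same_blockU.
by case/orP=> /same_block_imP[p [q [-> ->]]]; [apply: Qa | apply: Qb].
Qed.

Lemma joined_top (n : nat) (a b : pmon n) (p q : vertex n) :
  same_block a p q -> joined a b (top_mid p) (top_mid q).
Proof.
move=> pq; apply: connect1; rewrite same_blockU; apply/orP; left.
by apply/same_block_imP; exists p, q.
Qed.

Lemma joined_bot (n : nat) (a b : pmon n) (p q : vertex n) :
  same_block b p q -> joined a b (mid_bot p) (mid_bot q).
Proof.
move=> pq; apply: connect1; rewrite same_blockU; apply/orP; right.
by apply/same_block_imP; exists p, q.
Qed.

Lemma glue (V A B W : finType) (g : A -> W) (h : B -> W) (s : V -> A)
    (i : V -> B) (eA eA' : rel A) (eB : rel B) (eW : rel W) :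
    injective g -> injective h -> (forall q, g (s q) = h (i q)) ->
    (forall m u, h m = g u -> exists q, m = i q /\ u = s q) ->
    (forall u v, eA u v ->
       (exists q r, [/\ u = s q, v = s r & connect eB (i q) (i r)]) \/
       eA' u v) ->
    (forall q r, connect eB (i q) (i r) -> connect eA (s q) (s r)) ->
    (forall u v, eA' u v -> eA u v) ->
    (forall w x, eW w x <->
       (exists m k, [/\ w = h m, x = h k & eB m k]) \/
       (exists u v, [/\ w = g u, x = g v & eA' u v])) ->
  forall u v, connect eA u v = connect eW (g u) (g v).
Proof.
move=> ginj hinj gs cross eA1 eA2 eA3 eWE u v; apply/idP/idP.
  move=> uv; suff: forall z, connect eA u z -> connect eW (g u) (g z) by apply.
  move=> z uz; pose Q z := connect eW (g u) (g z).
  apply: (@connect_inv A eA Q _ u z uz); last exact: connect0.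
  move=> x y /eA1[[q [r [-> -> qr]]]|xy]; rewrite /Q => Qx.
    apply: connect_trans Qx _; rewrite !gs.
    pose Q' z := connect eW (h (i q)) (h z).
    apply: (@connect_inv B eB Q' _ _ _ qr); last exact: connect0.
    move=> m k mk Qm; apply: connect_trans Qm (connect1 _).
    by apply/eWE; left; exists m, k.
  by apply: connect_trans Qx (connect1 _); apply/eWE; right; exists x, y.
move=> uv.
pose Q1 w := exists q m, [/\ w = h m, connect eA u (s q) & connect eB (i q) m].
pose Q w := (exists z, w = g z /\ connect eA u z) \/ Q1 w.
have: Q (g v).
  apply: (@connect_inv W eW Q _ _ _ uv); last by left; exists u.
  move=> w x /eWE[[m [k [-> -> mk]]]|[y [z [-> -> yz]]]].
    case=> [[y [/cross[q [em ->]] uq]]|[q [m' [/hinj <- uq qm]]]]; right.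
      by exists q, k; split=> //; rewrite -em; apply: connect1.
    by exists q, k; split=> //; apply: connect_trans qm (connect1 mk).
  have ez : connect eA y z by apply/connect1/eA3.
  case=> [[y' [/ginj <- uy]]|[q [m [/esym/cross[r [em ey]] uq qm]]]]; left.
    by exists z; split=> //; apply: connect_trans uy ez.
  exists z; split=> //; apply: connect_trans uq (connect_trans _ ez).
  by rewrite ey; apply: eA2; rewrite -em.
case=> [[z [/ginj -> //]]|[q [m [/esym/cross[r [em ->]] uq qm]]]].
by apply: connect_trans uq (eA2 _ _ _); rewrite -em.
Qed.

Lemma pmulA (n : nat) : associative (@pmul n).
Proof.
move=> a b c; apply/esym/pmon_ext => p q; rewrite !same_block_mul /joined.
pose W : finType := (vertex n + vertex n)%type.
pose fa (x : vertex n) : W :=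
  match x with inl x => inl (inl x) | inr x => inr (inl x) end.
pose fb (x : vertex n) : W := inr x.
pose fc (x : vertex n) : W :=
  match x with inl x => inr (inr x) | inr x => inl (inr x) end.
pose im (f : vertex n -> W) (d : pmon n) :=
  [set f @: (A : {set vertex n}) | A in blocks d].
pose eW := same_block (im fa a :|: im fb b :|: im fc c).
pose gl (u : vertex3 n) : W :=
  match u with inl p => inl p | inr x => inr (inr x) end.
pose hl (u : vertex3 n) : W :=
  match u with inl (inl x) => inl (inl x) | inl (inr x) => inr (inr x)
             | inr x => inr (inl x) end.
pose gr (u : vertex3 n) : W :=
  match u with inl p => inl p | inr x => inr (inl x) end.
pose hr (u : vertex3 n) : W :=
  match u with inl (inl x) => inr (inl x) | inl (inr x) => inl (inr x)
             | inr x => inr (inr x) end.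
transitivity (connect eW (gl (inl p)) (gl (inl q))).
  apply: (@glue _ _ _ W gl hl (@top_mid n) inl _
    (same_block [set @mid_bot n @: (A : {set vertex n}) | A in blocks c])
    (same_block ([set @top_mid n @: (A : {set vertex n}) | A in blocks a]
       :|: [set @mid_bot n @: (A : {set vertex n}) | A in blocks b]))).
  - by move=> [[]x|x] [[]y|y] //= [->].
  - by move=> [[]x|x] [[]y|y] //= [->].
  - by case.
  - by case=> [[]x|x] [[]y|y] //= [->]; do [by exists (inl y) | by exists (inr y)].
  - move=> u v; rewrite same_blockU => /orP[|->]; last by right.
    case/same_block_imP=> r [t [-> -> rt]]; left; exists r, t.
    by move: rt; rewrite same_block_mul.
  - move=> r t rt; apply: connect1; rewrite same_blockU; apply/orP; left.
    by apply/same_block_imP; exists r, t; rewrite same_block_mul.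
  - by move=> u v uv; rewrite same_blockU uv orbT.
  - move=> w x; rewrite /eW !same_blockU -orbA; split.
      case/or3P=> /same_block_imP[r [t [-> -> rt]]].
      + left; exists (top_mid r), (top_mid t); split.
        * by case: (r).
        * by case: (t).
        * rewrite same_blockU; apply/orP; left.
          by apply/same_block_imP; exists r, t.
      + left; exists (mid_bot r), (mid_bot t); split.
        * by case: (r).
        * by case: (t).
        * rewrite same_blockU; apply/orP; right.
          by apply/same_block_imP; exists r, t.
      + right; exists (mid_bot r), (mid_bot t); split.
        * by case: (r).
        * by case: (t).
        * by apply/same_block_imP; exists r, t.
    case=> [[u [v [-> -> ]]]|[u [v [-> -> ]]]].
      rewrite same_blockU; case/orP=> /same_block_imP[r [t [-> -> rt]]];
        apply/or3P.
      + apply: Or31; apply/same_block_imP; exists r, t; split=> //.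
        * by case: (r).
        * by case: (t).
      + apply: Or32; apply/same_block_imP; exists r, t; split=> //.
        * by case: (r).
        * by case: (t).
    case/same_block_imP=> r [t [-> -> rt]]; apply/or3P.
    apply: Or33; apply/same_block_imP; exists r, t; split=> //.
    * by case: (r).
    * by case: (t).
apply/esym; rewrite -[gl _]/(gr (inl p)) -[gl (inl q)]/(gr (inl q)).
apply: (@glue _ _ _ W gr hr (@mid_bot n) inl _
  (same_block [set @top_mid n @: (A : {set vertex n}) | A in blocks a])
  (same_block ([set @top_mid n @: (A : {set vertex n}) | A in blocks b]
     :|: [set @mid_bot n @: (A : {set vertex n}) | A in blocks c]))).
- by move=> [[]x|x] [[]y|y] //= [->].
- by move=> [[]x|x] [[]y|y] //= [->].
- by case.
- by case=> [[]x|x] [[]y|y] //= [->]; do [by exists (inl y) | by exists (inr y)].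
- move=> u v; rewrite same_blockU => /orP[->|]; first by right.
  case/same_block_imP=> r [t [-> -> rt]]; left; exists r, t.
  by move: rt; rewrite same_block_mul.
- move=> r t rt; apply: connect1; rewrite same_blockU; apply/orP; right.
  by apply/same_block_imP; exists r, t; rewrite same_block_mul.
- by move=> u v uv; rewrite same_blockU uv.
- move=> w x; rewrite /eW !same_blockU -orbA; split.
    case/or3P=> /same_block_imP[r [t [-> -> rt]]].
    + right; exists (top_mid r), (top_mid t); split.
      * by case: (r).
      * by case: (t).
      * by apply/same_block_imP; exists r, t.
    + left; exists (top_mid r), (top_mid t); split.
      * by case: (r).
      * by case: (t).
      * rewrite same_blockU; apply/orP; left.
        by apply/same_block_imP; exists r, t.
    + left; exists (mid_bot r), (mid_bot t); split.
      * by case: (r).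
      * by case: (t).
      * rewrite same_blockU; apply/orP; right.
        by apply/same_block_imP; exists r, t.
  case=> [[u [v [-> -> ]]]|[u [v [-> -> ]]]].
    rewrite same_blockU; case/orP=> /same_block_imP[r [t [-> -> rt]]];
      apply/or3P.
    + apply: Or32; apply/same_block_imP; exists r, t; split=> //.
      * by case: (r).
      * by case: (t).
    + apply: Or33; apply/same_block_imP; exists r, t; split=> //.
      * by case: (r).
      * by case: (t).
  case/same_block_imP=> r [t [-> -> rt]]; apply/or3P.
  apply: Or31; apply/same_block_imP; exists r, t; split=> //.
  * by case: (r).
  * by case: (t).
Qed.

Lemma same_block_one (n : nat) (p q : vertex n) :
  same_block (pone n) p q =
    (match p with inl x | inr x => x end == match q with inl x | inr x => x end).
Proof.
apply/same_blockP/eqP => [[_ [/imsetP[x _ ->]]]|].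
  by rewrite !inE => /orP[]/eqP-> /orP[]/eqP->.
set x := match p with inl x | inr x => x end => ex.
exists [set inl x; inr x]; split; first exact: imset_f.
  by rewrite /x; case: (p) => y; rewrite !inE eqxx ?orbT.
by rewrite ex; case: (q) => y; rewrite !inE eqxx ?orbT.
Qed.

Lemma pmul1 (n : nat) : left_id (pone n) (@pmul n).
Proof.
move=> a; apply: pmon_ext => p q; rewrite same_block_mul; apply/idP/idP.
  pose c (u : vertex3 n) : vertex n := match u with inl p => p | inr x => inl x end.
  move=> pq; pose Q u := same_block a p (c u).
  apply: (@joined_ind _ _ _ Q _ _ _ _ pq); last exact: same_block_refl.
    by move=> [] x [] y; rewrite same_block_one => /eqP ->.
  by move=> [] x [] y xy; rewrite /Q /= => /same_block_trans; apply.
have J r : joined (pone n) a (inl r) (mid_bot r).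
  case: r => x; last exact: connect0.
  by apply: (@joined_top _ _ _ (inl x) (inr x)); rewrite same_block_one.
move=> pq; apply: joined_trans (J p) (joined_trans (joined_bot _ pq) _).
by rewrite joined_sym.
Qed.

Lemma pmulr1 (n : nat) : right_id (pone n) (@pmul n).
Proof.
move=> a; apply: pmon_ext => p q; rewrite same_block_mul; apply/idP/idP.
  pose c (u : vertex3 n) : vertex n := match u with inl p => p | inr x => inr x end.
  move=> pq; pose Q u := same_block a p (c u).
  apply: (@joined_ind _ _ _ Q _ _ _ _ pq); last exact: same_block_refl.
    by move=> [] x [] y xy; rewrite /Q /= => /same_block_trans; apply.
  by move=> [] x [] y; rewrite same_block_one => /eqP ->.
have J r : joined a (pone n) (inl r) (top_mid r).
  case: r => x; first exact: connect0.
  by apply: (@joined_bot _ _ _ (inr x) (inl x)); rewrite same_block_one.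
move=> pq; apply: joined_trans (J p) (joined_trans (joined_top _ pq) _).
by rewrite joined_sym.
Qed.

HB.instance Definition _ n :=
  isMonoid.Build (pmon n) (@pmulA n) (@pmul1 n) (@pmulr1 n).

Definition transversal_block (n : nat) (B : {set vertex n}) : bool :=
  [exists x : 'I_n, inl x \in B] && [exists x : 'I_n, inr x \in B].

Definition rank (n : nat) (a : pmon n) : nat :=
  #|[set B in blocks a | transversal_block B]|.

Lemma rank_mul_le (n : nat) (a b : pmon n) : rank (a * b) <= rank a.
Proof.
have /and3P[_ tria _] := blocks_partition a.
have /and3P[_ tri _] := blocks_partition (a * b).
pose G (A : {set vertex n}) : {set vertex n} :=
  if [pick x : 'I_n | inl x \in A] is Some x then pblock (a * b) (inl x) else A.
apply: leq_trans (leq_imset_card G _); apply/subset_leq_card/subsetP => C.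
rewrite inE => /andP[abC /andP[/existsP[x xC] /existsP[y yC]]].
have: [exists z : 'I_n, (inl z \in C) && transversal_block (pblock a (inl z))].
  apply/contraT; rewrite negb_exists => /forallP nC.
  have xy : joined a b (inl (inl x)) (inl (inr y)).
    by rewrite -same_block_mul; apply/same_blockP; exists C.
  pose Q (u : vertex3 n) := exists2 z, u = inl (inl z) & inl z \in C.
  suff QI : forall u v, joined a b u v -> Q u -> Q v.
    have Qx : Q (inl (inl x)) by exists x.
    by have [] := QI _ _ xy Qx.
  apply: joined_ind.
    move=> [z|z] [t|t] zt [z' //= [<-] zC].
      exists t => //; rewrite -(def_pblock tri abC zC) -same_block_pblock.
      by rewrite same_block_mul; apply: (joined_top b zt).
    case/negP: (nC z); rewrite zC /=; apply/andP; split; apply/existsP.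
      by exists z; rewrite -same_block_pblock same_block_refl.
    by exists t; rewrite -same_block_pblock.
  by move=> [z|z] [t|t] zt [].
case/existsP=> z /andP[zC tz]; apply/imsetP; exists (pblock a (inl z)).
  rewrite inE tz pblock_mem //.
  by have /and3P[/eqP-> _ _] := blocks_partition a; rewrite inE.
rewrite /G; case: pickP => [t|/(_ z)]; last first.
  by rewrite -same_block_pblock same_block_refl.
rewrite -same_block_pblock => zt.
have: same_block (a * b) (inl z) (inl t).
  by rewrite same_block_mul; apply: (joined_top b zt).
rewrite same_block_pblock (def_pblock tri abC zC) => tC.
by rewrite (def_pblock tri abC tC).
Qed.

(* The ideal P_n \ S_n of partitions that are not units. *)
Record sing (n : nat) := Sing {
  sing_val :> pmon n;
  sing_rank : rank sing_val < n
}.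

HB.instance Definition _ n := [isSub for @sing_val n].
HB.instance Definition _ n := [Finite of sing n by <:].

Lemma sing_closed (n : nat) : mulg_closed (fun a : pmon n => rank a < n).
Proof. by move=> a b an _; apply: leq_ltn_trans (rank_mul_le a b) an. Qed.

HB.instance Definition _ n :=
  SubChoice_isSubSemigroup.Build (pmon n) _ (sing n) (@sing_closed n).

Definition ebar_blocks (n : nat) (r : 'I_n) : {set {set vertex n}} :=
  [set [set inl r]; [set inr r]] :|:
  [set [set inl x; inr x] | x : 'I_n & x != r].

Lemma ebar_partition (n : nat) (r : 'I_n) :
  partition (ebar_blocks r) [set: vertex n].
Proof.
apply: (@partition_of _ _ (fun p =>
  match p with inl x | inr x =>
    if x == r then [set p] else [set inl x; inr x] end)).
- move=> B; rewrite !inE => /orP[/orP[]/eqP->|/imsetP[x _ ->]]; apply/set0Pn.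
  + by exists (inl r); rewrite inE.
  + by exists (inr r); rewrite inE.
  + by exists (inl x); rewrite !inE eqxx.
- case=> x; rewrite !inE; have [->|xr] := eqVneq x r; rewrite ?eqxx ?orbT //;
    by apply/orP; right; apply: imset_f; rewrite inE.
- by case=> x; case: ifP; rewrite !inE eqxx ?orbT.
- move=> B p; rewrite !inE => /orP[/orP[]/eqP->|/imsetP[x]].
  + by rewrite inE => /eqP->; rewrite eqxx.
  + by rewrite inE => /eqP->; rewrite eqxx.
  + by rewrite !inE => /negPf xr ->; rewrite !inE => /orP[]/eqP->; rewrite xr.
Qed.

Definition ebar (n : nat) (r : 'I_n) : pmon n := PMon (ebar_partition r).

Lemma ebar_rank (n : nat) (r : 'I_n) : rank (ebar r) < n.
Proof.
have /leq_ltn_trans-> // : rank (ebar r) <= #|[set x | x != r]|.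
  apply: leq_trans (leq_imset_card (fun x : 'I_n => [set inl x; inr x] : {set vertex n}) _).
  apply/subset_leq_card/subsetP => B; rewrite inE => /andP[/setUP[]].
    by case/set2P=> -> /andP[/existsP[x] + /existsP[y]]; rewrite !inE.
  by case/imsetP=> x xr -> _; apply: imset_f; move: xr; rewrite !inE.
rewrite -[X in _ < X]card_ord; apply/proper_card/properP.
by split; [apply/subsetP | exists r; rewrite // inE eqxx].
Qed.

(* Meaningful for distinct i and j; when i = j it is the identity. *)
Definition tbar_blocks (n : nat) (i j : 'I_n) : {set {set vertex n}} :=
  [set inl i; inl j; inr i; inr j] |:
  [set [set inl x; inr x] | x : 'I_n & x \notin [set i; j]].

Lemma tbar_partition (n : nat) (i j : 'I_n) :
  partition (tbar_blocks i j) [set: vertex n].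
Proof.
apply: (@partition_of _ _ (fun p =>
  match p with inl x | inr x =>
    if x \in [set i; j] then [set inl i; inl j; inr i; inr j]
    else [set inl x; inr x] end)).
- move=> B; rewrite !inE => /orP[/eqP->|/imsetP[x _ ->]]; apply/set0Pn.
  + by exists (inl i); rewrite !inE eqxx.
  + by exists (inl x); rewrite !inE eqxx.
- by case=> x; case: ifP => xr; apply/setU1P; [left | right; apply: imset_f |
    left | right; apply: imset_f]; rewrite // inE xr.
- by case=> x; case: ifP; rewrite !inE ?eqxx ?orbT // => /orP[]/eqP->;
    rewrite eqxx ?orbT.
- move=> B p; rewrite in_setU1 => /orP[/eqP->|/imsetP[x]].
  + by rewrite !inE -!orbA => /or4P[]/eqP->; rewrite !inE eqxx ?orbT.
  + by rewrite inE => /negPf xr ->; rewrite !inE => /orP[]/eqP->; rewrite xr.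
Qed.

Definition tbar (n : nat) (i j : 'I_n) : pmon n := PMon (tbar_partition i j).

Lemma tbarC (n : nat) (i j : 'I_n) : tbar i j = tbar j i.
Proof.
apply: val_inj => /=; rewrite /tbar_blocks (setUC [set j] [set i]).
congr (_ |: _); apply/setP => p; rewrite !inE -!orbA orbCA; congr (_ || (_ || _)).
exact: orbC.
Qed.

Lemma tbar_rank (n : nat) (i j : 'I_n) : i != j -> rank (tbar i j) < n.
Proof.
move=> ij.
have /leq_ltn_trans-> // : rank (tbar i j) <= #|[set x | x != j]|.
  apply: leq_trans (leq_imset_card (fun x : 'I_n =>
    (if x == i then [set inl i; inl j; inr i; inr j]
     else [set inl x; inr x]) : {set vertex n}) _).
  apply/subset_leq_card/subsetP => B; rewrite inE => /andP[/setU1P[->|+] _].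
    by apply/imsetP; exists i; rewrite ?inE // eqxx.
  case/imsetP=> x; rewrite !inE negb_or => /andP[xi xj] ->.
  by apply/imsetP; exists x; rewrite ?inE // (negPf xi).
rewrite -[X in _ < X]card_ord; apply/proper_card/properP.
by split; [apply/subsetP | exists j; rewrite // inE eqxx].
Qed.

Definition sing_e (n : nat) (r : 'I_n) : sing n := Sing (ebar_rank r).

Definition sing_t (n : nat) (i j : 'I_n) (ij : i != j) : sing n :=
  Sing (tbar_rank ij).

(* The non-empty word x s, given by its first letter and remaining letters. *)
Record fsg (X : Type) := Fsg { fsg_head : X; fsg_tail : seq X }.

Definition fsg_pair (X : Type) (w : fsg X) : X * seq X :=
  (fsg_head w, fsg_tail w).

Definition pair_fsg (X : Type) (w : X * seq X) : fsg X := Fsg w.1 w.2.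

Lemma fsg_pairK (X : Type) : cancel (@fsg_pair X) (@pair_fsg X).
Proof. by case. Qed.

HB.instance Definition _ (X : choiceType) :=
  Choice.copy (fsg X) (can_type (@fsg_pairK X)).

Definition fsg_mul (X : Type) (u v : fsg X) : fsg X :=
  Fsg (fsg_head u) (fsg_tail u ++ fsg_head v :: fsg_tail v).

Lemma fsg_mulA (X : Type) : associative (@fsg_mul X).
Proof. by move=> [x u] [y v] [z w]; rewrite /fsg_mul /= -catA. Qed.

HB.instance Definition _ (X : choiceType) :=
  isSemigroup.Build (fsg X) (@fsg_mulA X).

Definition fsg_letter (X : Type) (x : X) : fsg X := Fsg x [::].

Definition fsg_lift (X : choiceType) (S : semigroupType) (f : X -> S)
    (w : fsg X) : S :=
  foldl (fun s x => s * f x) (f (fsg_head w)) (fsg_tail w).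

Lemma fsg_lift_mul (X : choiceType) (S : semigroupType) (f : X -> S) :
  {morph fsg_lift f : u v / u * v}.
Proof.
move=> [x u] [y v]; rewrite /fsg_lift /= foldl_cat /=.
by elim: v (f y) => //= z v IHv s; rewrite -mulgA IHv.
Qed.

HB.instance Definition _ (X : choiceType) (S : semigroupType) (f : X -> S) :=
  isMultiplicative.Build (fsg X) S (fsg_lift f) (@fsg_lift_mul X S f).

Lemma fsg_lift_letter (X : choiceType) (S : semigroupType) (f : X -> S) (x : X) :
  fsg_lift f (fsg_letter x) = f x.
Proof. by []. Qed.

Lemma fsg_lift_unique (X : choiceType) (S : semigroupType) (f : X -> S)
    (h : {multiplicative fsg X -> S}) :
  (forall x, h (fsg_letter x) = f x) -> h =1 fsg_lift f.
Proof.
move=> hf [x s]; elim/last_ind: s => [|s y IHs]; first exact: hf.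
have -> : Fsg x (rcons s y) = Fsg x s * fsg_letter y by rewrite -cats1.
by rewrite gmulfM IHs hf fsg_lift_mul.
Qed.

Inductive congruence_gen (S : semigroupType) (R : S -> S -> Prop) :
    S -> S -> Prop :=
  | cong_rel u v of R u v : congruence_gen R u v
  | cong_refl u : congruence_gen R u u
  | cong_sym u v of congruence_gen R u v : congruence_gen R v u
  | cong_trans u v w of congruence_gen R u v & congruence_gen R v w :
      congruence_gen R u w
  | cong_mul u v u' v' of congruence_gen R u v & congruence_gen R u' v' :
      congruence_gen R (u * u') (v * v').

Definition presentation_via (X : choiceType) (S : semigroupType)
    (R : fsg X -> fsg X -> Prop) (phi : {multiplicative fsg X -> S}) : Prop :=
  (forall s : S, exists w : fsg X, phi w = s) /\
  (forall u v : fsg X, phi u = phi v <-> congruence_gen R u v).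

(* The pair (i, j), with i < j, stands for the letter t_ij. *)
Definition T_index (n : nat) : Type := {p : 'I_n * 'I_n | p.1 < p.2}.

HB.instance Definition _ n := Finite.on (T_index n).

Definition letter (n : nat) : choiceType := ('I_n + T_index n)%type.

Lemma T_index_subproof (n : nat) (i j : 'I_n) (ij : i != j) :
  let p := if i < j then (i, j) else (j, i) in p.1 < p.2.
Proof. by case: ltngtP => //= /val_inj eij; rewrite eij eqxx in ij. Qed.

Definition T_pair (n : nat) (i j : 'I_n) (ij : i != j) : T_index n :=
  exist _ (if i < j then (i, j) else (j, i)) (T_index_subproof ij).

Lemma T_index_neq (n : nat) (p : T_index n) : (sval p).1 != (sval p).2.
Proof.
by case: p => -[i j] /= ij; apply: contraTneq ij => ->; rewrite ltnn.
Qed.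

Definition e_ (n : nat) (i : 'I_n) : fsg (letter n) := fsg_letter (inl i).

(* t_ij, for distinct i and j in either order. *)
Definition t_ (n : nat) (i j : 'I_n) (ij : i != j) : fsg (letter n) :=
  fsg_letter (inr (T_pair ij)).

Lemma t_sym (n : nat) (i j : 'I_n) (ij : i != j) (ji : j != i) :
  t_ ij = t_ ji.
Proof.
congr (fsg_letter (inr _)); apply: val_inj => /=.
by case: ltngtP => // /val_inj eij; rewrite eij eqxx in ij.
Qed.

Definition generator (n : nat) (x : letter n) : sing n :=
  match x with
  | inl r => sing_e r
  | inr p => sing_t (T_index_neq p)
  end.

Definition phi (n : nat) : {multiplicative fsg (letter n) -> sing n} :=
  fsg_lift (@generator n).

Lemma phi_e (n : nat) (r : 'I_n) : phi n (e_ r) = sing_e r.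
Proof. by []. Qed.

Lemma phi_t (n : nat) (i j : 'I_n) (ij : i != j) : phi n (t_ ij) = sing_t ij.
Proof.
by apply: val_inj => /=; case: ifP => // _; rewrite tbarC.
Qed.

(* Each relation takes the proofs of distinctness that its letters t_ need;
   together these express exactly the stated distinctness conditions. *)
Inductive rel_R (n : nat) : fsg (letter n) -> fsg (letter n) -> Prop :=
  | R1 (i : 'I_n) : rel_R (e_ i * e_ i) (e_ i)
  | R2 (i j : 'I_n) of i != j : rel_R (e_ i * e_ j) (e_ j * e_ i)
  | R3 (i j : 'I_n) (ij : i != j) : rel_R (t_ ij * t_ ij) (t_ ij)
  | R4 (i j k l : 'I_n) (ij : i != j) (kl : k != l) :
      rel_R (t_ ij * t_ kl) (t_ kl * t_ ij)
  | R5 (i j k : 'I_n) (ij : i != j) (jk : j != k) (ki : k != i) :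
      rel_R (t_ ij * t_ jk) (t_ jk * t_ ki)
  | R6 (i j k : 'I_n) (ij : i != j) of k \notin [set i; j] :
      rel_R (t_ ij * e_ k) (e_ k * t_ ij)
  | R7 (i j k : 'I_n) (ij : i != j) of k \in [set i; j] :
      rel_R (t_ ij * e_ k * t_ ij) (t_ ij)
  | R8 (i j k : 'I_n) (ij : i != j) of k \in [set i; j] :
      rel_R (e_ k * t_ ij * e_ k) (e_ k)
  | R9 (i j k : 'I_n)
             (ki : k != i) (ij : i != j) (jk : j != k)
             (kj : k != j) (ji : j != i) (ik : i != k) :
      rel_R (e_ k * t_ ki * e_ i * t_ ij * e_ j * t_ jk * e_ k)
            (e_ k * t_ kj * e_ j * t_ ji * e_ i * t_ ik * e_ k)
  | R10 (i j k l : 'I_n)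
                (ki : k != i) (ij : i != j) (jl : j != l) (lk : l != k)
                (kl : k != l) (li : l != i) (jk : j != k) :
      rel_R (e_ k * t_ ki * e_ i * t_ ij * e_ j * t_ jl * e_ l * t_ lk * e_ k)
            (e_ k * t_ kl * e_ l * t_ li * e_ i * t_ ij * e_ j * t_ jk * e_ k).

(* Main.v *)
From HB Require Import structures.
Require Import Defs.
From mathcomp Require Import all_boot fingroup perm.
From mathcomp Require Import generic_quotient boolp.

Set Implicit Arguments.
Unset Strict Implicit.
Unset Printing Implicit Defensive.

Local Open Scope group_scope.
Local Open Scope quotient_scope.

(** A partition a is determined by three pieces of data: the equivalence it
induces on the upper points, the one it induces on the lower points, and a
partial bijection f joining one upper point to one lower point of each
transversal block.  In words, a is the product of all t_xy with x, y in one
upper block, then a word for f, then all t_xy with x', y' in one lower block.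
The theorem says that such words exist for every singular a, that they exhaust
all words up to the relations, and that the choices made in f do not matter.

The heart of the matter is the word for f, where permutations must be
simulated although no permutation is available.  The word e_a t_ab e_b is a
_slide_: seen as a move on a board with one hole at a, the token at b moves to a
and the hole moves to b.  Slides along a path of the hole realise every
permutation, as in a fifteen puzzle on a complete graph, and a partial
bijection with domain the complement of A is obtained by sliding from a hole
a in A and then removing the tokens in A.  Relations R7 and R8 make slides
invertible, R9 says that a triangular tour of the hole equals its inverse, and
R10 compares the two ways round a square.  These suffice to show that two paths
of the hole with the same permutation have the same value ([slide_eq]): a closed
path inside a set V of vertices is rewritten, for any other vertex m in V, as a
path avoiding m followed by at most two steps that displace the token m
([path_coset]); if the permutation is trivial these steps are absent, and V
shrinks by induction ([slide_closed]).  After removing the tokens in A only the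
values of the permutation outside A matter ([cut_slide_eq]).

Next, R7 moves the chosen representatives within the blocks, so all choices of f
give the same value ([normal_form_eq]); and multiplying a normal form by e_i or
t_ij gives a normal form of the product ([has_normal_form_mul_e],
[has_normal_form_mul_t]).  Hence the class of every word is the normal form of
the partition it represents, and equal partitions force equal classes.

All of this is carried out in an arbitrary monoid with elements e i and t i j
subject to the relations.  It is applied twice: to the monoid of words modulo the
relations for the kernel, and to the partition monoid itself for surjectivity,
where the normal form of a evaluates to a ([normal_formK]). *)

(** * Products of commuting idempotents *)

Section BigIdempotents.
Variables (M : monoidType) (I : finType) (g : I -> M).
Hypothesis gg : forall i, g i * g i = g i.
Hypothesis gC : forall i j, commute (g i) (g j).

Lemma absorb_prod (P : pred I) (m : M) :
  (forall i, P i -> m * g i = m) -> m * \prod_(i | P i) g i = m.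
Proof.
move=> mg; apply: (big_ind (fun x => m * x = m)); first exact: mulg1.
  by move=> x y mx my; rewrite mulgA mx my.
exact: mg.
Qed.

Lemma prod_absorb_factor (P : pred I) (i : I) :
  P i -> \prod_(j | P j) g j * g i = \prod_(j | P j) g j.
Proof.
move=> Pi; have : i \in index_enum I by rewrite mem_index_enum.
elim: (index_enum I) => // j s IHs; rewrite inE big_cons.
case: (eqVneq i j) => [<- _|_ /= si]; last first.
  by case: (P j); rewrite -?mulgA IHs.
rewrite Pi -mulgA; have -> // : \prod_(j <- s | P j) g j * g i = g i * \prod_(j <- s | P j) g j.
  apply: (big_ind (fun x => x * g i = g i * x)).
  - by rewrite mul1g mulg1.
  - by move=> x y xg yg; rewrite -mulgA yg mulgA xg mulgA.
  - by move=> k _; apply: gC.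
by rewrite mulgA gg.
Qed.

(** Among the elements commuting with all the factors, a product of commuting
idempotents is the only one that absorbs the factors and is absorbed by the
product.  Identities between products over different index sets reduce to this. *)
Lemma eq_prod_idempotents (P : pred I) (m : M) :
    (forall i, commute m (g i)) -> (forall i, P i -> m * g i = m) ->
    \prod_(i | P i) g i * m = \prod_(i | P i) g i ->
  m = \prod_(i | P i) g i.
Proof.
move=> mC mP Pm; rewrite -[LHS](absorb_prod mP).
by rewrite (commute_prod _ (fun i _ => mC i)).
Qed.

End BigIdempotents.

(** * The relations in an abstract monoid *)

(** Setting t i i = 1 makes t total and lets most relations hold without
distinctness conditions. *)
Record partition_relations (n : nat) (M : monoidType) (e : 'I_n -> M)
    (t : 'I_n -> 'I_n -> M) : Prop := PartitionRelations {
  rel_ee : forall i, e i * e i = e i;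
  rel_eC : forall i j, e i * e j = e j * e i;
  rel_t1 : forall i, t i i = 1;
  rel_t_sym : forall i j, t i j = t j i;
  rel_tt : forall i j, t i j * t i j = t i j;
  rel_tC : forall i j k l, t i j * t k l = t k l * t i j;
  rel_t3 : forall i j k, t i j * t j k = t j k * t k i;
  rel_te : forall i j k, k != i -> k != j -> t i j * e k = e k * t i j;
  rel_tet : forall i j, i != j -> t i j * e i * t i j = t i j;
  rel_ete : forall i j, i != j -> e i * t i j * e i = e i;
  rel_triangle : forall i j k, i != j -> j != k -> k != i ->
    e k * t k i * e i * t i j * e j * t j k * e k =
    e k * t k j * e j * t j i * e i * t i k * e k;
  rel_square : forall i j k l,
    k != i -> i != j -> j != l -> l != k -> l != i -> j != k ->
    e k * t k i * e i * t i j * e j * t j l * e l * t l k * e k =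
    e k * t k l * e l * t l i * e i * t i j * e j * t j k * e k
}.

(** * Sliding a hole *)

(** The position reached by each token when the hole starts at a and
successively visits the points of p. *)
Fixpoint slide_perm (n : nat) (a : 'I_n) (p : seq 'I_n) : {perm 'I_n} :=
  if p is b :: p' then tperm a b * slide_perm b p' else 1.

Lemma slide_perm_cat (n : nat) (a : 'I_n) (p q : seq 'I_n) :
  slide_perm a (p ++ q) = slide_perm a p * slide_perm (last a p) q.
Proof. by elim: p a => [|b p IHp] a /=; rewrite ?mul1g // IHp mulgA. Qed.

Lemma slide_perm_last (n : nat) (a : 'I_n) (p : seq 'I_n) :
  slide_perm a p a = last a p.
Proof. by elim: p a => [|b p IHp] a /=; rewrite ?perm1 // permM tpermL. Qed.

Lemma slide_perm_out (n : nat) (a x : 'I_n) (p : seq 'I_n) :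
  x \notin a :: p -> slide_perm a p x = x.
Proof.
elim: p a => [|b p IHp] a; first by rewrite perm1.
rewrite inE negb_or => /andP[xa xp]; rewrite /= permM tpermD 1?eq_sym ?IHp //.
by move: xp; rewrite inE negb_or eq_sym => /andP[].
Qed.

Lemma tpermE (T : finType) (x y z : T) :
  tperm x y z = if z == x then y else if z == y then x else z.
Proof. by case: tpermP => [->|->|/eqP/negPf-> /eqP/negPf->]; rewrite ?eqxx //; case: eqP. Qed.

Lemma slide_perm_triangle (n : nat) (a b c : 'I_n) : a != b -> b != c -> c != a ->
  slide_perm a [:: b; c; a] = tperm b c.
Proof.
move=> ab bc ca; apply/permP => x /=; rewrite !mulg1 !permM.
have [ba cb ac] : [/\ b != a, c != b & a != c] by split; rewrite eq_sym.
pose E := (negPf ab, negPf ba, negPf bc, negPf cb, negPf ac, negPf ca).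
have [->|xa] := eqVneq x a; first by rewrite !(tpermE, eqxx, E).
have [->|xb] := eqVneq x b; first by rewrite !(tpermE, eqxx, E).
have [->|xc] := eqVneq x c; first by rewrite !(tpermE, eqxx, E).
by rewrite !(tpermE, negPf xa, negPf xb, negPf xc).
Qed.

Lemma slide_perm_square (n : nat) (a b c d : 'I_n) :
    a != b -> b != c -> c != d -> d != a -> d != b -> a != c ->
  slide_perm a [:: b; c; d; a] = slide_perm a [:: d; b; c; a].
Proof.
move=> ab bc cd da db ac.
apply/permP => x /=; rewrite !mulg1 !permM.
have [ba cb ca] : [/\ b != a, c != b & c != a] by split; rewrite eq_sym.
have [dc ad bd] : [/\ d != c, a != d & b != d] by split; rewrite eq_sym.
pose E := (negPf ab, negPf ba, negPf bc, negPf cb, negPf ac, negPf ca,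
           negPf cd, negPf dc, negPf ad, negPf da, negPf bd, negPf db).
have [->|xa] := eqVneq x a; first by rewrite !(tpermE, eqxx, E).
have [->|xb] := eqVneq x b; first by rewrite !(tpermE, eqxx, E).
have [->|xc] := eqVneq x c; first by rewrite !(tpermE, eqxx, E).
have [->|xd] := eqVneq x d; first by rewrite !(tpermE, eqxx, E).
by rewrite !(tpermE, negPf xa, negPf xb, negPf xc, negPf xd).
Qed.

Section SlideWords.
Variables (n : nat) (M : monoidType) (e : 'I_n -> M) (t : 'I_n -> 'I_n -> M).

Definition slide1 (a b : 'I_n) : M := e a * t a b * e b.

Fixpoint slide (a : 'I_n) (p : seq 'I_n) : M :=
  if p is b :: p' then slide1 a b * slide b p' else e a.

Hypothesis ee : forall i, e i * e i = e i.

Lemma mul_slide1_e a b : slide1 a b * e b = slide1 a b.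
Proof. by rewrite /slide1 -mulgA ee. Qed.

Lemma slide3E a b c d : slide a [:: b; c; d] =
  e a * t a b * e b * t b c * e c * t c d * e d.
Proof. by rewrite /= mul_slide1_e /slide1 -!mulgA !(mulgA (e _) (e _)) !ee. Qed.

Lemma slide4E a b c d f : slide a [:: b; c; d; f] =
  e a * t a b * e b * t b c * e c * t c d * e d * t d f * e f.
Proof. by rewrite /= mul_slide1_e /slide1 -!mulgA !(mulgA (e _) (e _)) !ee. Qed.

End SlideWords.

Section Slides.
Variables (n : nat) (M : monoidType) (e : 'I_n -> M) (t : 'I_n -> 'I_n -> M).
Hypothesis H : partition_relations e t.

Notation slide1 := (slide1 e t).
Notation slide := (slide e t).
Implicit Types (A : {set 'I_n}) (a b : 'I_n) (p q : seq 'I_n).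

Lemma slide1_id a : slide1 a a = e a.
Proof. by rewrite /slide1 (rel_t1 H) mulg1 (rel_ee H). Qed.

Lemma mul_e_slide1 a b : e a * slide1 a b = slide1 a b.
Proof. by rewrite /slide1 !mulgA (rel_ee H). Qed.

(** Sliding back and forth only records the hole: this is where R7 and R8 meet. *)
Lemma slide1K a b : slide1 a b * slide1 b a = e a.
Proof.
have [<-|ab] := eqVneq a b; first by rewrite slide1_id (rel_ee H).
rewrite {2}/slide1 !mulgA (mul_slide1_e t (rel_ee H)) /slide1 (rel_t_sym H b a).
rewrite -[e a * _ * _ * _]mulgA -[e a * _ * _]mulgA (mulgA (t a b)).
by rewrite (rel_t_sym H a b) (rel_tet H) 1?eq_sym // (rel_t_sym H b a) (rel_ete H).
Qed.

Lemma mul_e_slide a p : e a * slide a p = slide a p.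
Proof. by case: p => [|b p] /=; rewrite ?(rel_ee H) // mulgA mul_e_slide1. Qed.

Lemma mul_slide_e a p : slide a p * e (last a p) = slide a p.
Proof. by elim: p a => [|b p IHp] a /=; rewrite ?(rel_ee H) // -mulgA IHp. Qed.

Lemma slide_cat a p q : slide a (p ++ q) = slide a p * slide (last a p) q.
Proof.
by elim: p a => [|b p IHp] a /=; rewrite ?mul_e_slide // IHp mulgA.
Qed.

Lemma slide_cons a b : slide a [:: b] = slide1 a b.
Proof. by rewrite /= (mul_slide1_e t (rel_ee H)). Qed.

(** Two routes of the hole are compared both by their values and by their
permutations, so that the two stay in step when routes are rewritten. *)
Definition path_eq a p q := slide a p = slide a q /\ slide_perm a p = slide_perm a q.

Lemma path_eq_sym a p q : path_eq a p q -> path_eq a q p.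
Proof. by case. Qed.
Lemma path_eq_trans a q p r : path_eq a p q -> path_eq a q r -> path_eq a p r.
Proof. by move=> [pq spq] [qr sqr]; split; rewrite ?pq ?spq. Qed.

Lemma path_eq_last a p q : path_eq a p q -> last a p = last a q.
Proof. by case=> _ pq; rewrite -!slide_perm_last pq. Qed.

Lemma path_eq_cat a p p' q q' :
  path_eq a p p' -> path_eq (last a p) q q' -> path_eq a (p ++ q) (p' ++ q').
Proof.
move=> pp [qq sqq]; have ep := path_eq_last pp; case: pp => pp spp.
by split; rewrite ?slide_cat ?slide_perm_cat ?pp ?spp ?qq ?sqq ep.
Qed.

Lemma path_eq_cancel a b : path_eq a [:: b; a] [::].
Proof.
by split; rewrite /= ?(mul_slide1_e t (rel_ee H)) ?slide1K // mulg1 (tpermC b a) tperm2.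
Qed.

Lemma path_eq_stay a : path_eq a [:: a] [::].
Proof. by split; rewrite /= ?(mul_slide1_e t (rel_ee H)) ?slide1_id // tperm1 mulg1. Qed.

Lemma path_eq_triangle a b c : a != b -> b != c -> c != a ->
  path_eq a [:: b; c; a] [:: c; b; a].
Proof.
move=> ab bc ca; split; last by rewrite !slide_perm_triangle 1?tpermC // eq_sym.
by rewrite !(slide3E t (rel_ee H)); apply: (rel_triangle H bc ca ab).
Qed.

Lemma path_eq_square a b c d :
    a != b -> b != c -> c != d -> d != a -> d != b -> a != c ->
  path_eq a [:: b; c; d; a] [:: d; b; c; a].
Proof.
move=> ab bc cd da db ac; split; last exact: slide_perm_square.
by rewrite !(slide4E t (rel_ee H)); apply: (rel_square H) => //; rewrite eq_sym.
Qed.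

Lemma path_eq_catl a p q q' :
  path_eq (last a p) q q' -> path_eq a (p ++ q) (p ++ q').
Proof. exact: path_eq_cat. Qed.

Lemma path_eq_catr a p p' q : path_eq a p p' -> path_eq a (p ++ q) (p' ++ q).
Proof. by move=> pp; apply: path_eq_cat. Qed.

(** The token m is moved to j while the hole goes on to k by way of h.  The
same effect is reached by first touring h and k without disturbing m, and only
then taking the two steps that displace m: the square relation, used twice,
pushes m to the end of the tour, and the triangle relation reorders the rest. *)
Lemma path_eq_detour j m h k :
    j != m -> m != h -> h != k -> k != j -> k != m -> j != h ->
  path_eq j [:: m; h; k] [:: h; k; j; m; k].
Proof.
move=> jm mh hk kj km jh.
have step1 : path_eq j [:: m; h; k] [:: h; k; m; j; k].
  apply: path_eq_trans (path_eq_sym (path_eq_catl (p := [:: m; h; k]) (path_eq_cancel k j))) _.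
  have sq1 := path_eq_catr [:: k] (path_eq_square jm mh hk kj km jh).
  apply: path_eq_trans sq1 _.
  apply: (path_eq_catr [:: k] (path_eq_square _ _ _ _ _ _)); by rewrite // eq_sym.
apply: path_eq_trans step1 (path_eq_sym _).
apply: path_eq_trans (path_eq_sym (path_eq_catl (p := [:: h; k; j; m; k]) (path_eq_cancel k j))) _.
apply: path_eq_trans (path_eq_catr [:: k] (path_eq_catl (p := [:: h; k; j]) (path_eq_triangle jm _ kj))) _.
  by rewrite eq_sym.
exact: (path_eq_catr [:: m; j; k] (path_eq_catl (p := [:: h; k]) (path_eq_cancel k j))).
Qed.

(** Coset enumeration for the permutations of V modulo those fixing m: the
remainder r depends only on where the token m and the hole end up.  It is empty
when m is at home, [:: m] when the hole took its place, and [:: m; h] when the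
hole is at a third point h. *)
Lemma path_coset (V : {set 'I_n}) (m a : 'I_n) (p : seq 'I_n) :
    m != a -> a \in V -> {subset p <= V} ->
  exists q r : seq 'I_n, [/\ {subset q <= V :\ m}, path_eq a p (q ++ r) &
    [\/ r = [::], r = [:: m] |
        exists h, [/\ r = [:: m; h], h != m, h != last a q & h \in V]]].
Proof.
move=> ma aV; elim/last_ind: p => [|p k IHp] pV.
  by exists [::], [::]; split=> //; apply: Or31.
have kV : k \in V by apply: pV; rewrite mem_rcons inE eqxx.
have {IHp} [x xp|q [r [qV pqr hr]]] := IHp.
  by apply: pV; rewrite mem_rcons inE xp orbT.
have qkV (x : 'I_n) : x \in V -> x != m -> {subset rcons q x <= V :\ m}.
  move=> xV xm y; rewrite mem_rcons inE => /orP[/eqP->|/qV //].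
  by rewrite !inE xm.
have lm : last a q != m.
  have := mem_last a q; rewrite inE => /orP[/eqP->|/qV]; first by rewrite eq_sym.
  by rewrite !inE => /andP[].
have {pqr} pqr : path_eq a (rcons p k) (q ++ r ++ [:: k]).
  by rewrite catA -cats1; apply: path_eq_catr.
have step q' r' : path_eq (last a q) (r ++ [:: k]) (q' ++ r') ->
    path_eq a (rcons p k) ((q ++ q') ++ r').
  by move=> qr; rewrite -catA; apply: path_eq_trans pqr (path_eq_catl _).
case: hr pqr step => [->|->|[h [-> hm hl hV]]] pqr step.
- have [ekm|km] := eqVneq k m.
    by exists q, [:: m]; split=> //; [rewrite -ekm | apply: Or32].
  exists (rcons q k), [::]; split; [exact: qkV | | exact: Or31].
  by rewrite cats0 -(cats1 q).
- have [ekm|km] := eqVneq k m.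
    exists q, [:: m]; split=> //; last exact: Or32.
    rewrite -[X in X ++ _](cats0 q); apply: step; rewrite ekm.
    exact: (path_eq_catl (p := [:: m]) (path_eq_stay m)).
  have [ekl|kl] := eqVneq k (last a q).
    exists q, [::]; split=> //; last exact: Or31.
    rewrite -[X in X ++ _](cats0 q); apply: step; rewrite ekl.
    exact: path_eq_cancel.
  by exists q, [:: m; k]; split=> //; apply: Or33; exists k.
(* From here on the token m is at last a q and the hole at h. *)
have [ekh|kh] := eqVneq k h.
  exists q, [:: m; h]; split=> //; last by apply: Or33; exists h.
  rewrite -[X in X ++ _](cats0 q); apply: step; rewrite ekh.
  exact: (path_eq_catl (p := [:: m; h]) (path_eq_stay h)).
have [ekm|km] := eqVneq k m.
  exists q, [:: m]; split=> //; last exact: Or32.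
  rewrite -[X in X ++ _](cats0 q); apply: step; rewrite ekm.
  exact: (path_eq_catl (p := [:: m]) (path_eq_cancel m h)).
have [ekl|kl] := eqVneq k (last a q).
  exists (rcons q h), [:: m; k]; split; first exact: qkV.
    rewrite -(cats1 q); apply: step; rewrite ekl.
    by apply: path_eq_triangle; rewrite // eq_sym.
  by apply: Or33; exists k; rewrite last_rcons; split=> //; rewrite ekl eq_sym.
exists (q ++ [:: h; k; last a q]), [:: m; k]; split.
- move=> x; rewrite mem_cat => /orP[/qV //|]; rewrite !inE.
  case/or3P=> /eqP->; rewrite ?hm ?km ?hV //= lm /=.
  by have := mem_last a q; rewrite inE => /orP[/eqP->|/qV/setD1P[]].
- by apply: step; apply: path_eq_detour; rewrite // eq_sym.
- by apply: Or33; exists k; split=> //; rewrite last_cat.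
Qed.

(** Induction on V: when the permutation is trivial, the token m is at home at
the end, so the remainder given by [path_coset] is empty and m can be dropped
from V. *)
Lemma slide_closed (V : {set 'I_n}) (a : 'I_n) (p : seq 'I_n) :
  a \in V -> {subset p <= V} -> slide_perm a p = 1 -> slide a p = e a.
Proof.
have [k] := ubnP #|V|; elim: k V p => // k IHk V p Vk aV pV p1.
have [V1|[m mV]] := set_0Vmem (V :\ a).
  have {}pV x : x \in p -> x = a.
    move=> /pV xV; apply/eqP; apply/contraT => xa.
    by have := in_set0 x; rewrite -V1 !inE xa xV.
  elim: p pV {p1} => // b p IHp pV /=; rewrite (pV b) ?mem_head // slide1_id.
  by rewrite IHp ?(rel_ee H) // => x xp; apply: pV; rewrite inE xp orbT.
case/setD1P: mV => ma mV.
have [q [r [qV [-> ep] hr]]] := path_coset ma aV pV; move: p1; rewrite {}ep.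
have qm : slide_perm a q m = m.
  apply: slide_perm_out; rewrite inE negb_or ma.
  by apply/negP => /qV; rewrite !inE eqxx.
have lm : last a q != m.
  by rewrite -slide_perm_last -qm (inj_eq perm_inj) eq_sym.
case: hr => [->|->|[h [-> hm hl hV]]].
- rewrite cats0; apply: (IHk (V :\ m)) => //; last by rewrite !inE eq_sym ma.
  by move: Vk; rewrite (cardsD1 m) mV.
- move/permP/(_ m); rewrite slide_perm_cat permM qm /= mulg1 tpermR perm1.
  by move/eqP; rewrite (negPf lm).
- move/permP/(_ m); rewrite slide_perm_cat permM qm /= mulg1 permM tpermR perm1.
  by rewrite tpermD 1?(eq_sym m) // => /eqP; rewrite (negPf lm).
Qed.

Lemma path_back a p : exists q,
  [/\ last (last a p) q = a, path_eq a (p ++ q) [::] &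
      path_eq (last a p) (q ++ p) [::]].
Proof.
elim: p a => [|b p IHp] a; first by exists [::].
have [q [lq pq qp]] := IHp b; exists (rcons q a); rewrite last_rcons; split=> //.
  rewrite -rcons_cat -cats1.
  apply: path_eq_trans (path_eq_cancel a b).
  exact: (path_eq_catl (p := [:: b]) (path_eq_catr [:: a] pq)).
rewrite -cats1 -catA /=.
apply: path_eq_trans qp; apply: path_eq_catl; rewrite lq.
exact: (path_eq_catr p (path_eq_cancel b a)).
Qed.

(** Routes with equal permutations end at the same hole, so one followed by the
reverse of the other is closed with trivial permutation. *)
Lemma slide_eq a p q : slide_perm a p = slide_perm a q -> slide a p = slide a q.
Proof.
move=> pq; have lpq : last a p = last a q by rewrite -!slide_perm_last pq.
have [r [lr qr rq]] := path_back a q.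
rewrite -(mul_slide_e a p) lpq -[e _]/(slide (last a q) [::]) -rq.1.
rewrite -{1}lpq -slide_cat catA slide_cat last_cat lpq lr.
rewrite (slide_closed (V := setT)) ?inE ?mul_e_slide //.
  by move=> x; rewrite inE.
by rewrite slide_perm_cat pq lpq -slide_perm_cat qr.2.
Qed.

Lemma e_slide1_last a b : e b * slide1 a b = e b * e a.
Proof.
have [->|ab] := eqVneq a b; first by rewrite slide1_id.
rewrite /slide1 !mulgA (rel_eC H b a) (rel_t_sym H) -mulgA -mulgA (mulgA (e b)).
by rewrite (rel_ete H) 1?eq_sym.
Qed.

Lemma slide1_e_first a b : slide1 a b * e a = e b * e a.
Proof.
have [->|ab] := eqVneq a b; first by rewrite slide1_id.
by rewrite /slide1 -!mulgA (rel_eC H b a) !mulgA (rel_ete H).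
Qed.

Lemma e_slide1 a b x : e x * slide1 a b = slide1 a b * e (tperm a b x).
Proof.
case: tpermP => [->|->|/eqP xa /eqP xb].
- by rewrite mul_e_slide1 (mul_slide1_e t (rel_ee H)).
- by rewrite e_slide1_last slide1_e_first.
rewrite /slide1 -!mulgA (rel_eC H b) !mulgA (rel_eC H x); congr (_ * _).
by rewrite -!mulgA (rel_te H).
Qed.

(** The pair {x, y} follows its tokens; the hole must be avoided, since
t a y does not commute past e a. *)
Lemma t_slide1 a b x y : x != a -> y != a ->
  t x y * slide1 a b = slide1 a b * t (tperm a b x) (tperm a b y).
Proof.
have [<-|ab] := eqVneq a b; first by move=> *; rewrite tperm1 !perm1 slide1_id (rel_te H) // eq_sym.
wlog xb : x y / x != b => [IH|] xa ya.
  have [exb|xb] := eqVneq x b; last exact: IH.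
  have [eyb|yb] := eqVneq y b; last first.
    by rewrite (rel_t_sym H) (rel_t_sym H (tperm _ _ _)); apply: IH.
  by rewrite exb eyb !(rel_t1 H) mul1g mulg1.
rewrite (tpermD (_ : a != x) (_ : b != x)) 1?eq_sym // /slide1.
rewrite !mulgA (rel_te H) 1?eq_sym // -(mulgA (e a)).
have [->|yb] := eqVneq y b.
  rewrite tpermR (rel_t_sym H a b) (rel_t3 H x b a) (rel_t_sym H a x).
  by rewrite mulgA -mulgA (rel_te H) ?mulgA // eq_sym.
rewrite tpermD 1?eq_sym // (rel_tC H) mulgA -!mulgA; congr (_ * (_ * _)).
by rewrite (rel_te H) // eq_sym.
Qed.

Lemma e_slide a p x : e x * slide a p = slide a p * e (slide_perm a p x).
Proof.
elim: p a x => [|b p IHp] a x /=; first by rewrite perm1 (rel_eC H).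
by rewrite mulgA e_slide1 -!mulgA IHp permM.
Qed.

Lemma t_slide a p x y : x != a -> y != a ->
  t x y * slide a p = slide a p * t (slide_perm a p x) (slide_perm a p y).
Proof.
elim: p a x y => [|b p IHp] a x y xa ya /=.
  by rewrite !perm1 (rel_te H) // eq_sym.
rewrite mulgA t_slide1 // -!mulgA !permM -IHp //;
  by rewrite -[b in _ != b](tpermL a b) (inj_eq perm_inj).
Qed.

(** A transposition (x y) is a single slide when the hole is at x or y, and the
triangular tour a, x, y, a otherwise. *)
Lemma path_of_perm (V : {set 'I_n}) (a : 'I_n) (s : {perm 'I_n}) :
  a \in V -> perm_on V s -> exists2 p, {subset p <= V} & slide_perm a p = s.
Proof.
have [k] := ubnP #|[set x | s x != x]|; elim: k a s => // k IHk a s sk aV sV.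
have [s1|[x]] := set_0Vmem [set x | s x != x].
  exists [::] => //; apply/permP => x; rewrite perm1.
  by have := in_set0 x; rewrite -s1 inE => /negPn/eqP.
rewrite inE => sx; have xV : x \in V by apply: (subsetP sV); rewrite inE.
have yV : s x \in V by rewrite perm_closed.
have IH b : b \in V -> exists2 p, {subset p <= V} & slide_perm b p = tperm x (s x) * s.
  move=> bV; apply: IHk => //.
    rewrite -ltnS; apply: leq_trans sk; rewrite ltnS; apply: proper_card.
    apply/properP; split; last first.
      by exists (s x); rewrite inE ?permM ?tpermR ?eqxx // (inj_eq perm_inj).
    apply/subsetP => y; rewrite !inE permM; case: tpermP => [->|->|_ _] //.
    by rewrite eqxx.
  apply: perm_onM => //; apply/subsetP => y; rewrite inE.
  by case: tpermP => [->|->|_ _]; rewrite ?eqxx.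
have rot : s = tperm x (s x) * (tperm x (s x) * s) by rewrite mulgA tperm2 mul1g.
have [eax|ax] := eqVneq a x.
  have [p pV ps] := IH (s x) yV; exists (s x :: p).
    by move=> y; rewrite inE => /orP[/eqP->|/pV].
  by rewrite /= ps eax -rot.
have [eay|ay] := eqVneq a (s x).
  have [p pV ps] := IH x xV; exists (x :: p).
    by move=> y; rewrite inE => /orP[/eqP->|/pV].
  by rewrite /= ps eay tpermC -rot.
have [p pV ps] := IH a aV; exists [:: x, s x, a & p].
  by move=> y; rewrite !inE => /or4P[/eqP->|/eqP->|/eqP->|/pV].
rewrite -[x :: _]/([:: x; s x; a] ++ p) slide_perm_cat.
by rewrite slide_perm_triangle ?[x == _]eq_sym ?[s x == a]eq_sym //= ps -rot.
Qed.

Lemma slide_perm_surj (a : 'I_n) (s : {perm 'I_n}) : exists p, slide_perm a p = s.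
Proof.
have [|p _ <-] := @path_of_perm setT a s (in_setT a); last by exists p.
by apply/subsetP => x; rewrite !inE.
Qed.

Definition cut (A : {set 'I_n}) : M := \prod_(i in A) e i.

Lemma cutC A x : (forall i, i \in A -> commute x (e i)) -> commute x (cut A).
Proof. exact: commute_prod. Qed.

Lemma cut_e A i : i \in A -> cut A * e i = cut A.
Proof. exact: (prod_absorb_factor (rel_ee H) (rel_eC H)). Qed.

Lemma e_cut A i : e i * cut A = cut (i |: A).
Proof.
have cC j : commute (e j) (cut A) by apply: cutC => *; apply: (rel_eC H).
apply: eq_prod_idempotents => [j|j|].
- by apply/commute_sym/commuteM => //; apply: (rel_eC H).
- rewrite in_setU1 => /orP[/eqP->|jA]; last by rewrite -mulgA cut_e.
  by rewrite -mulgA -cC mulgA (rel_ee H).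
rewrite mulgA -/(cut _) cut_e ?setU11 //.
by apply: absorb_prod => j jA; rewrite cut_e // setU1r.
Qed.

Lemma cut_slide1 A a b : a \in A -> b \in A -> cut A * slide1 a b = cut A.
Proof.
move=> aA bA; rewrite -{1}(cut_e bA) -mulgA e_slide1_last mulgA !cut_e //.
Qed.

Lemma cut_slide_in A a p : a \in A -> {subset p <= A} -> cut A * slide a p = cut A.
Proof.
elim: p a => [|b p IHp] a aA pA /=; first exact: cut_e.
have bA : b \in A by apply: pA; rewrite mem_head.
rewrite mulgA cut_slide1 // IHp // => x xp.
by apply: pA; rewrite inE xp orbT.
Qed.

(** Under cut A the position of c is vacant as well, so the hole can be moved
there for free; this changes the permutation only on A. *)
Lemma cut_slide_rcons A a p c : c \in A ->
  cut A * slide a p = cut A * slide a (rcons p (slide_perm a p c)).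
Proof.
move=> cA; rewrite -(cut_e cA) -!mulgA !e_slide -cats1 slide_cat slide_cons; congr (_ * _).
set d := slide_perm a p c.
rewrite slide_perm_cat /= mulg1 permM -/d tpermR -mulgA slide1_e_first.
by rewrite (rel_eC H) mulgA mul_slide_e.
Qed.

(** A product cut A * slide a p depends only on the partial bijection: neither on
which vacant point serves as hole, nor on the values of the permutation on A. *)
Lemma cut_slide_eq (A : {set 'I_n}) a b p q : a \in A -> b \in A ->
  (forall x, x \notin A -> slide_perm a p x = slide_perm b q x) ->
  cut A * slide a p = cut A * slide b q.
Proof.
move=> aA bA pq; set s := slide_perm a p; set s' := slide_perm b q.
pose r := s * s'^-1; have rA : perm_on A r.
  apply/subsetP => x; rewrite inE; apply: contraR => xA.
  by rewrite permM /s pq // permK.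
have cA : r a \in A by rewrite (perm_closed _ rA).
have [u uA su] : exists2 u, {subset u <= A} & slide_perm a u = r * tperm b (r a).
  apply: path_of_perm => //; apply: perm_onM => //; apply/subsetP => x.
  by rewrite inE; case: tpermP => [->|->|]; rewrite ?eqxx.
have lu : last a u = b by rewrite -slide_perm_last su permM tpermR.
(* The route u stays inside A and ends at b, so that q can follow it; the factor
   tperm b (r a) is cancelled by the final free move of the hole. *)
rewrite (cut_slide_rcons b q cA) -[in RHS](cut_slide_in aA uA) -mulgA.
rewrite -[X in slide X (rcons _ _)]lu -slide_cat.
congr (_ * _); apply: slide_eq; rewrite slide_perm_cat su lu -cats1.
rewrite slide_perm_cat /= mulg1 -slide_perm_last -/s' -tpermJ conjgE.
by rewrite !mulgA mulgK -[r * _ * _]mulgA tperm2 mulg1 /r mulgKV.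
Qed.

End Slides.

(** * Multiplying a partition by a generator *)

Definition label (n : nat) (p : vertex n) : 'I_n :=
  match p with inl x | inr x => x end.

Lemma same_block_ebar (n : nat) (i : 'I_n) (p q : vertex n) :
  same_block (ebar i) p q = (p == q) || (label p == label q) && (label p != i).
Proof.
apply/same_blockP/idP => [[B []]|/orP[/eqP<-|/andP[/eqP pq pi]]].
- rewrite !inE => /orP[/orP[]/eqP->|/imsetP[x]].
  + by rewrite !inE => /eqP-> /eqP->; rewrite eqxx.
  + by rewrite !inE => /eqP-> /eqP->; rewrite eqxx.
  rewrite !inE => xi ->; rewrite !inE => /orP[]/eqP-> /orP[]/eqP->;
    by rewrite /= eqxx xi ?orbT.
- by have /same_blockP[B [? ? _]] := same_block_refl (ebar i) p; exists B.
exists [set inl (label p); inr (label p)]; split.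
- by rewrite inE; apply/orP; right; apply: imset_f; rewrite inE.
- by case: p {pq pi} => x; rewrite !inE eqxx ?orbT.
by rewrite pq; case: q {pq} => x; rewrite !inE eqxx ?orbT.
Qed.

Lemma same_block_tbar (n : nat) (i j : 'I_n) (p q : vertex n) :
  same_block (tbar i j) p q =
    (label p == label q) || (label p \in [set i; j]) && (label q \in [set i; j]).
Proof.
apply/same_blockP/idP => [[B []]|].
- rewrite in_setU1 => /orP[/eqP->|/imsetP[x]].
    have h r : r \in [set inl i; inl j; inr i; inr j] -> label r \in [set i; j].
      by rewrite !inE -!orbA => /or4P[]/eqP-> /=; rewrite eqxx ?orbT.
    by move=> /h-> /h->; rewrite orbT.
  by rewrite inE => _ ->; rewrite !inE => /orP[]/eqP-> /orP[]/eqP->; rewrite /= eqxx.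
have [pij|pij] /= := boolP (label p \in [set i; j]).
  move=> qij; exists [set inl i; inl j; inr i; inr j].
  have h (r : vertex n) : label r \in [set i; j] ->
      r \in [set inl i; inl j; inr i; inr j].
    by case: r => x /=; rewrite !inE => /orP[]/eqP->; rewrite eqxx ?orbT.
  split; [exact: setU11 | exact: h | apply: h].
  by case/orP: qij => // /eqP<-.
rewrite orbF => /eqP pq; exists [set inl (label p); inr (label p)]; split.
- by apply/setU1P; right; apply: imset_f; rewrite inE.
- by case: p {pq pij} => x; rewrite !inE eqxx ?orbT.
by rewrite pq; case: q {pq} => x; rewrite !inE eqxx ?orbT.
Qed.

Lemma joined_mid_bot (n : nat) (a b : pmon n) (x : 'I_n) :
  same_block b (inl x) (inr x) -> joined a b (inl (inr x)) (inr x).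
Proof.
by move=> bx; rewrite joined_sym; apply: (@joined_bot _ _ _ (inl x) (inr x)).
Qed.

(** On the right, e_i cuts the point i' off its block. *)
Lemma same_block_mul_ebar (n : nat) (a : pmon n) (i : 'I_n) (p q : vertex n) :
  same_block (a * ebar i) p q =
    (p == q) || [&& p != inr i, q != inr i & same_block a p q].
Proof.
rewrite same_block_mul; apply/idP/idP => [pq|].
  have [pi|pi] /= := boolP (p == inr i :> vertex n).
    pose Q (u : vertex3 n) := u = inl p; rewrite orbF.
    suff : Q (inl q) by case=> ->.
    apply: (joined_ind _ _ pq) => // r s rs; rewrite /Q (eqP pi).
      by case: r rs => x.
    case: r rs => x; rewrite same_block_ebar //= => /orP[/eqP<- //|].
    by move=> /andP[_ xi] [exi]; rewrite exi eqxx in xi.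
  apply/orP; right.
  pose Q (u : vertex3 n) : bool := match u with
    | inl r => (r != inr i) && same_block a p r | inr x => same_block a p (inr x) end.
  rewrite -/(Q (inl q)); apply: (joined_ind (Q := Q) _ _ pq).
  - have QE r : Q (top_mid r) = same_block a p r by case: r.
    by move=> r s rs; rewrite !QE => /same_block_trans; apply.
  - move=> r s; rewrite same_block_ebar => /orP[/eqP-> //|/andP[/eqP rs ri]].
    have QE t : label t != i -> Q (mid_bot t) = same_block a p (inr (label t)).
      case: t => // x /= xi; rewrite andbC; case: (same_block a p _) => //=.
    by rewrite !QE ?rs // -rs.
  by rewrite /Q pi same_block_refl.
case/orP=> [/eqP->|/and3P[pi qi pq]]; first exact: connect0.
have J r : r != inr i -> joined a (ebar i) (inl r) (top_mid r).
  case: r => x xi; first exact: connect0.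
  apply: joined_mid_bot; rewrite same_block_ebar /= eqxx /=.
  by apply: contra xi => /eqP->.
apply: joined_trans (J p pi) (joined_trans (joined_top _ pq) _).
by rewrite joined_sym J.
Qed.

(** On the right, t_ij merges the blocks of i' and j'. *)
Lemma same_block_mul_tbar (n : nat) (a : pmon n) (i j : 'I_n) (p q : vertex n) :
  same_block (a * tbar i j) p q =
    [|| same_block a p q,
        same_block a p (inr i) && same_block a (inr j) q |
        same_block a p (inr j) && same_block a (inr i) q].
Proof.
have tr := @same_block_trans n a.
rewrite same_block_mul; apply/idP/idP => [pq|].
  pose R r := [|| same_block a p r,
        same_block a p (inr i) && same_block a (inr j) r |
        same_block a p (inr j) && same_block a (inr i) r].
  pose c (u : vertex3 n) : vertex n := match u with inl r => r | inr x => inr x end.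
  have Rtr r s : same_block a r s -> R r -> R s.
    move=> rs /or3P[h|/andP[h1 h2]|/andP[h1 h2]]; apply/or3P.
    - by apply: Or31; apply: tr rs.
    - by apply: Or32; rewrite h1; apply: tr rs.
    - by apply: Or33; rewrite h1; apply: tr rs.
  have Rij : R (inr i) = R (inr j).
    rewrite /R !same_block_refl !andbT.
    by do 2!case: (same_block a p _); rewrite ?orbT.
  suff : R (c (inl q)) by [].
  apply: (joined_ind (Q := fun u => R (c u)) _ _ pq).
  - by move=> [x|x] [y|y]; apply: Rtr.
  - move=> r s; rewrite same_block_tbar.
    have cE t : c (mid_bot t) = inr (label t) by case: t.
    rewrite !cE => /orP[/eqP->//|].
    by rewrite !inE => /andP[/orP[]/eqP-> /orP[]/eqP->]; rewrite ?Rij.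
  by rewrite /R /= same_block_refl.
have J r : joined a (tbar i j) (inl r) (top_mid r).
  case: r => x; first exact: connect0.
  by apply: joined_mid_bot; rewrite same_block_tbar /= eqxx.
have J' r s : same_block a r s -> joined a (tbar i j) (inl r) (inl s).
  move=> rs; apply: joined_trans (J r) (joined_trans (joined_top _ rs) _).
  by rewrite joined_sym.
have Jij : joined a (tbar i j) (inl (inr i)) (inl (inr j)).
  apply: (@joined_bot _ _ _ (inr i) (inr j)).
  by rewrite same_block_tbar /= !inE !eqxx !orbT.
case/or3P=> [/J'//|/andP[/J' h1 /J' h2]|/andP[/J' h1 /J' h2]].
  exact: joined_trans h1 (joined_trans Jij h2).
by apply: joined_trans h1 (joined_trans _ h2); rewrite joined_sym.
Qed.

Definition upper (n : nat) (a : pmon n) : rel 'I_n :=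
  fun x y => same_block a (inl x) (inl y).
Definition across (n : nat) (a : pmon n) : rel 'I_n :=
  fun x y => same_block a (inl x) (inr y).
Definition lower (n : nat) (a : pmon n) : rel 'I_n :=
  fun x y => same_block a (inr x) (inr y).

Section BlockRelations.
Variables (n : nat) (a : pmon n).
Implicit Types x y z : 'I_n.

Lemma upper_refl x : upper a x x. Proof. exact: same_block_refl. Qed.
Lemma lower_refl x : lower a x x. Proof. exact: same_block_refl. Qed.
Lemma upper_sym x y : upper a x y = upper a y x. Proof. exact: same_block_sym. Qed.
Lemma lower_sym x y : lower a x y = lower a y x. Proof. exact: same_block_sym. Qed.
Lemma upper_trans x y z : upper a x y -> upper a y z -> upper a x z.
Proof. exact: same_block_trans. Qed.
Lemma lower_trans x y z : lower a x y -> lower a y z -> lower a x z.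
Proof. exact: same_block_trans. Qed.
Lemma upper_across x y z : upper a x y -> across a y z -> across a x z.
Proof. exact: same_block_trans. Qed.
Lemma across_lower x y z : across a x y -> lower a y z -> across a x z.
Proof. exact: same_block_trans. Qed.
Lemma across_upper x y z : across a x z -> across a y z -> upper a x y.
Proof. by move=> xz; rewrite /across same_block_sym; apply: same_block_trans. Qed.
Lemma across_lower2 x y z : across a x y -> across a x z -> lower a y z.
Proof. by rewrite /across same_block_sym; apply: same_block_trans. Qed.

End BlockRelations.

(** * Normal forms *)

(** Representatives for the transversal blocks: x in the complement of A is
joined to (s x)', and each transversal block contains exactly one such x.  The
partial bijection is encoded by any permutation s extending it. *)
Record transversal_rep (n : nat) (a : pmon n) (A : {set 'I_n})
    (s : {perm 'I_n}) : Prop := TransversalRep {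
  rep_across : forall x, x \notin A -> across a x (s x);
  rep_cover : forall x y, across a x y -> exists2 z, z \notin A & upper a x z;
  rep_inj : forall x y, x \notin A -> y \notin A -> upper a x y -> x = y
}.

(** When i' shares its block with another lower point j', nothing forces i' to
be the lower representative: the choice can be moved to j'. *)
Lemma transversal_rep_avoid (n : nat) (a : pmon n) (A : {set 'I_n})
    (s : {perm 'I_n}) (i j : 'I_n) :
    transversal_rep a A s -> j != i -> lower a i j ->
  exists2 s', transversal_rep a A s' & s'^-1 i \in A.
Proof.
move=> repA ji ij; have [iA|iA] := boolP (s^-1 i \in A); first by exists s.
have jA : s^-1 j \in A.
  apply: contraT => jA; case/eqP: ji; apply: (@perm_inj _ s^-1).
  apply: (rep_inj repA) => //; apply: across_upper (rep_across repA jA) _.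
  have := rep_across repA iA; rewrite !permKV => li.
  exact: across_lower li ij.
exists (s * tperm i j); last by rewrite invMg permM tpermV tpermL.
split; [move=> z zA | exact: (rep_cover repA) | exact: (rep_inj repA)].
have := rep_across repA zA; rewrite permM; case: tpermP => [->|sz|//].
  by move=> zi; apply: across_lower ij.
by case/negP: zA; rewrite -(permK s z) sz.
Qed.

Section NormalForm.
Variables (n : nat) (M : monoidType) (e : 'I_n -> M) (t : 'I_n -> 'I_n -> M).
Hypothesis H : partition_relations e t.
Implicit Types (r : rel 'I_n) (A B : {set 'I_n}) (x y z c : 'I_n) (p q : seq 'I_n)
  (a b : pmon n).

Definition glue_all r : M := \prod_(xy : 'I_n * 'I_n | r xy.1 xy.2) t xy.1 xy.2.

Lemma glue_all_absorb r x y : r x y -> glue_all r * t x y = glue_all r.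
Proof.
exact: (@prod_absorb_factor _ _ (fun xy => t xy.1 xy.2) (fun _ => rel_tt H _ _)
  (fun _ _ => rel_tC H _ _ _ _) (fun xy => r xy.1 xy.2) (x, y)).
Qed.

Lemma commute_glue_all r (m : M) :
  (forall x y, r x y -> commute m (t x y)) -> commute m (glue_all r).
Proof. by move=> mt; apply: commute_prod => -[x y] /mt. Qed.

Lemma t_glue_allC r x y : t x y * glue_all r = glue_all r * t x y.
Proof. by apply: commute_glue_all => *; apply: (rel_tC H). Qed.

Lemma glue_all_eq r (m : M) :
    (forall x y, commute m (t x y)) -> (forall x y, r x y -> m * t x y = m) ->
    glue_all r * m = glue_all r ->
  m = glue_all r.
Proof. by move=> mC mr rm; apply: eq_prod_idempotents => [xy|xy rxy|]; [apply: mC | apply: mr | ]. Qed.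

Lemma eq_glue_all r r' : r =2 r' -> glue_all r = glue_all r'.
Proof. by move=> rr; apply: eq_bigl => -[x y] /=. Qed.

(** By R5 the pairs absorbed by an element form a transitive relation. *)
Lemma absorb_trans (m : M) x y z : m * t x y = m -> m * t y z = m -> m * t x z = m.
Proof.
move=> xy yz; have : m = m * t y z * t z x.
  by rewrite -mulgA -(rel_t3 H x) mulgA xy yz.
by rewrite yz (rel_t_sym H x) => <-.
Qed.

Definition normal_form a A x p : M :=
  glue_all (upper a) * (cut e A * slide e t x p) * glue_all (lower a).

(** The formula for r' is the explicit form of the equivalence generated by r
and the pair (i, j). *)
Lemma glue_all_join r r' i j :
    (forall x, r x x) -> (forall x y, r x y = r y x) ->
    (forall x y, r' x y = [|| r x y, r x i && r j y | r x j && r i y]) ->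
  glue_all r' = glue_all r * t i j.
Proof.
move=> rr rs r'E; apply/esym/glue_all_eq => [x y|x y|].
- apply/commute_sym/commuteM; last exact: (rel_tC H).
  exact: t_glue_allC.
- set m := glue_all r * t i j => r'xy.
  have mr z w : r z w -> m * t z w = m.
    by move=> zw; rewrite /m -mulgA (rel_tC H) mulgA (glue_all_absorb zw).
  have mij : m * t i j = m by rewrite /m -mulgA (rel_tt H).
  have mji : m * t j i = m by rewrite (rel_t_sym H).
  move: r'xy; rewrite r'E => /or3P[/mr //|/andP[/mr xi /mr jy]|/andP[/mr xj /mr iy]].
    exact: absorb_trans xi (absorb_trans mij jy).
  exact: absorb_trans xj (absorb_trans mji iy).
rewrite mulgA [X in X * _ = _]absorb_prod.
  by rewrite glue_all_absorb // r'E !rr orbT.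
by move=> [x y] /= xy; rewrite glue_all_absorb // r'E xy.
Qed.

(** The class of i is recovered from the relation with i isolated by one link
from i to a former classmate j. *)
Lemma glue_all_isolate r r' i j :
    (forall x y, r x y = r y x) -> (forall x y z, r x y -> r y z -> r x z) ->
    r i j -> j != i ->
    (forall x y, r' x y = (x == y) || [&& x != i, y != i & r x y]) ->
  glue_all r = glue_all r' * t i j.
Proof.
move=> rs rt ij ji r'E; set m := glue_all r' * t i j.
have off_i y z : y != i -> z != i -> r y z -> m * t y z = m.
  move=> yi zi yz; have yz' : r' y z by rewrite r'E yi zi yz orbT.
  by rewrite /m -mulgA (rel_tC H) mulgA (glue_all_absorb yz').
have mij : m * t i j = m by rewrite /m -mulgA (rel_tt H).
have at_i z : r i z -> m * t i z = m.
  have [->|zi] := eqVneq z i; first by rewrite (rel_t1 H) mulg1.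
  by move=> iz; apply: absorb_trans mij (off_i _ _ ji zi _); rewrite rs in ij; apply: rt ij iz.
apply/esym/glue_all_eq => [y z|y z|].
- by apply/commute_sym/commuteM; [apply: t_glue_allC | apply: (rel_tC H)].
- have [->|yi] := eqVneq y i; first exact: at_i.
  have [->|zi] := eqVneq z i; last exact: off_i.
  by rewrite rs (rel_t_sym H y); apply: at_i.
rewrite mulgA [X in X * _ = _]absorb_prod; first exact: glue_all_absorb.
case=> y z; rewrite /= r'E => /orP[/eqP<-|/and3P[_ _ yz]].
  by rewrite (rel_t1 H) mulg1.
exact: glue_all_absorb.
Qed.

Lemma cut_slide_rebase A x p y (s := slide_perm x p) : x \in A -> y \in A ->
  exists2 q, slide_perm y q = s & cut e A * slide e t x p = cut e A * slide e t y q.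
Proof.
move=> xA yA; have [q qs] := slide_perm_surj y s.
by exists q => //; apply: cut_slide_eq => // z _; rewrite qs.
Qed.

Lemma cut_mul_slide A x p : cut e A * slide e t x p = cut e (x |: A) * slide e t x p.
Proof.
rewrite -(e_cut H) -[in LHS](mul_e_slide H) mulgA; congr (_ * _).
by apply/commute_sym/cutC => *; apply: (rel_eC H).
Qed.

(** Once x and z are glued, either of them may carry the outgoing line: R7 in the
form t x z = t x z * e x * t x z turns the line at z into one at x, at the cost
of one slide. *)
Lemma glue_cut_move B x z p : x \notin B -> z \notin B -> x != z ->
  t x z * (cut e (z |: B) * slide e t z p) =
  t x z * (cut e (x |: B) * slide e t x (z :: p)).
Proof.
move=> xB zB xz; rewrite -!cut_mul_slide /=.
have cB y : commute (cut e B) (e y).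
  by apply/commute_sym/cutC => *; apply: (rel_eC H).
have tB : commute (cut e B) (t x z).
  apply/commute_sym/cutC => i iB; apply: (rel_te H); by apply: contraTneq iB => ->.
have sB : commute (cut e B) (slide1 e t x z) by do 2!apply: commuteM => //.
rewrite (mulgA (cut e B)) sB /slide1 !mulgA (rel_tet H xz) -(mulgA _ (e z)).
by rewrite -cB !mulgA -(mulgA _ (e z)) (mul_e_slide H).
Qed.

(** The mirror image of [glue_cut_move]: when the final hole is glued to c, the
line ending at c may end at the hole instead. *)
Lemma slide_t_last x p c :
  slide e t x p * t (last x p) c = slide e t x (rcons p c) * t (last x p) c.
Proof.
rewrite -cats1 (slide_cat H) (slide_cons H).
have [<-|xc] := eqVneq (last x p) c.
  by rewrite slide1_id // (mul_slide_e H).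
rewrite /slide1 !mulgA (mul_slide_e H) -!mulgA; congr (_ * _).
by rewrite mulgA (rel_t_sym H) (rel_tet H) // eq_sym.
Qed.

(** Each representative z chosen by s but not by the first system is exchanged
with the representative w of the same block, shrinking the difference A :\: B. *)
Lemma align_domain a A B x p s : x \in A ->
    transversal_rep a A (slide_perm x p) -> transversal_rep a B s ->
  exists y q, [/\ y \in B, transversal_rep a B (slide_perm y q) &
                  normal_form a A x p = normal_form a B y q].
Proof.
have [k] := ubnP #|A :\: B|; elim: k A x p => // k IHk A x p Ak xA repA repB.
have [AB|[z]] := set_0Vmem (A :\: B).
  suff <- : A = B by exists x, p.
  apply/eqP; rewrite eqEsubset -setD_eq0 AB eqxx /=; apply/subsetP => w wB.
  apply: contraT => wA; have wt := rep_across repA wA.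
  have [z zB wz] := rep_cover repB wt.
  have zA : z \notin A.
    by apply: contra zB => zA; apply: contraT => zB; have := in_set0 z; rewrite -AB inE zA zB.
  by case/negP: zB; rewrite -(rep_inj repA wA zA wz).
rewrite inE => /andP[zB zA].
have [w wA zw] := rep_cover repA (rep_across repB zB).
have wz : w != z by apply: contraNneq wA => ->.
have wB : w \in B.
  by apply: contraT => wB; rewrite (rep_inj repB zB wB zw) eqxx in wz.
have [q qs cq] := cut_slide_rebase p xA zA.
set A' := w |: (A :\ z).
have wA' : w \in A' by rewrite setU11.
have nf : normal_form a A x p = normal_form a A' w (z :: q).
  rewrite /normal_form cq -(glue_all_absorb (r := upper a) (x := w) (y := z)); last first.
    by rewrite upper_sym.
  rewrite -[in LHS](setD1K zA) -!(mulgA _ (t w z)) glue_cut_move // ?inE ?eqxx //.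
  by rewrite (negPf wA) andbF.
have repA' : transversal_rep a A' (slide_perm w (z :: q)).
  rewrite /= qs; have nA' v : (v \notin A') = (v != w) && ((v == z) || (v \notin A)).
    by rewrite !inE negb_or negb_and negbK.
  have zw' : upper a w z by rewrite upper_sym.
  split=> [v|v y|u v].
  - rewrite nA' permM => /andP[vw /orP[/eqP->|vA]].
      by rewrite tpermR; apply: upper_across zw (rep_across repA wA).
    rewrite tpermD 1?eq_sym //; first exact: (rep_across repA).
    by apply: contraNneq vA => ->.
  - move=> /(rep_cover repA)[u uA vu]; have [euw|uw] := eqVneq u w.
      exists z; first by rewrite nA' eqxx eq_sym wz.
      by rewrite euw in vu; apply: upper_trans vu zw'.
    by exists u; rewrite // nA' uw uA orbT.
  rewrite !nA' => /andP[uw uz] /andP[vw vz] uv.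
  case/orP: uz vz uv => [/eqP->|uA] /orP[/eqP->|vA] uv //.
  - by case/eqP: vw; apply/esym/(rep_inj repA) => //; apply: upper_trans uv.
  - by case/eqP: uw; apply: (rep_inj repA) => //; apply: upper_trans uv zw.
  exact: (rep_inj repA).
have [|y [q' [yB repq' nfq']]] := IHk A' w (z :: q) _ wA' repA' repB.
  rewrite -ltnS; apply: leq_trans Ak; rewrite ltnS; apply: proper_card.
  apply/properP; split; last by exists z; rewrite !inE ?zA ?zB // eqxx eq_sym (negPf wz).
  apply/subsetP => v; rewrite !inE => /andP[vB /orP[/eqP evw|/andP[_ ->]]].
    by rewrite evw wB in vB.
  by rewrite vB.
by exists y, q'; split=> //; rewrite nf.
Qed.

(** With equal domains, the end points of the lines are corrected one by one: the
wanted end point s z is vacant, because each block carries a single line. *)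
Lemma align_image a A x p s : x \in A ->
    transversal_rep a A (slide_perm x p) -> transversal_rep a A s ->
  exists y q, [/\ y \in A, forall z, z \notin A -> slide_perm y q z = s z &
                  normal_form a A x p = normal_form a A y q].
Proof.
have [k] := ubnP #|[set z in ~: A | slide_perm x p z != s z]|.
elim: k x p => // k IHk x p sk xA repA reps.
have [D0|[z]] := set_0Vmem [set z in ~: A | slide_perm x p z != s z].
  exists x, p; split=> // z zA; apply/eqP; apply: contraT => zs.
  by have := in_set0 z; rewrite -D0 !inE zA zs.
rewrite !inE => /andP[zA zs]; set s' := slide_perm x p in sk repA zs.
pose y := s'^-1 (s z); have sy : s' y = s z by rewrite permKV.
have yA : y \in A.
  apply: contraT => yA; case/eqP: zs; rewrite -sy; congr (s' _).
  apply: (rep_inj repA) => //; apply: across_upper (rep_across reps zA) _.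
  by rewrite -sy; apply: (rep_across repA).
have [q qs cq] := cut_slide_rebase p xA yA.
have lq : last y q = s z by rewrite -slide_perm_last qs sy.
pose q' := rcons q (s' z).
have q's v : slide_perm y q' v = tperm (s z) (s' z) (s' v).
  by rewrite /q' -cats1 slide_perm_cat permM qs lq /= mulg1.
have nf : normal_form a A x p = normal_form a A y q'.
  have low : lower a (s z) (s' z).
    exact: across_lower2 (rep_across reps zA) (rep_across repA zA).
  have absorb : glue_all (lower a) = t (s z) (s' z) * glue_all (lower a).
    by rewrite t_glue_allC glue_all_absorb.
  rewrite /normal_form cq absorb -!mulgA; congr (_ * (_ * _)).
  by rewrite !mulgA -lq slide_t_last.
have stay v : v \notin A -> v != z -> slide_perm y q' v = s' v.
  move=> vA vz; rewrite q's tpermD ?(inj_eq perm_inj) 1?eq_sym //.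
  by rewrite -sy (inj_eq perm_inj); apply: contraNneq vA => ->.
have repq' : transversal_rep a A (slide_perm y q').
  split; [move=> v vA | exact: (rep_cover repA) | exact: (rep_inj repA)].
  have [->|vz] := eqVneq v z; last by rewrite stay //; apply: (rep_across repA).
  by rewrite q's tpermR; apply: (rep_across reps).
have [|w [u [wA us nfu]]] := IHk y q' _ yA repq' reps.
  rewrite -ltnS; apply: leq_trans sk; rewrite ltnS; apply: proper_card.
  apply/properP; split; last by exists z; rewrite !inE ?zA ?zs // q's tpermR eqxx.
  apply/subsetP => v; rewrite !inE => /andP[vA]; rewrite vA.
  have [->|vz] := eqVneq v z; first by rewrite q's tpermR eqxx.
  by rewrite stay.
by exists w, u; split=> //; rewrite nf.
Qed.

Lemma normal_form_eq a A B x y p q : x \in A -> y \in B ->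
    transversal_rep a A (slide_perm x p) -> transversal_rep a B (slide_perm y q) ->
  normal_form a A x p = normal_form a B y q.
Proof.
move=> xA yB repA repB.
have [z [u [zB repu ->]]] := align_domain xA repA repB.
have [w [v [wB vs ->]]] := align_image zB repu repB.
by rewrite /normal_form (cut_slide_eq H wB yB vs).
Qed.

End NormalForm.

(** * Normal forms are closed under multiplication by generators *)

Section MulGenerators.
Variables (n : nat) (a : pmon n).
Implicit Types x y i j : 'I_n.

Lemma upper_mul_ebar i : upper (a * ebar i) =2 upper a.
Proof.
move=> x y; rewrite /upper same_block_mul_ebar /=.
by apply: orb_idl => /eqP[->]; apply: same_block_refl.
Qed.

Lemma across_mul_ebar i x y : across (a * ebar i) x y = (y != i) && across a x y.
Proof. by rewrite /across same_block_mul_ebar. Qed.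

Lemma lower_mul_ebar i x y :
  lower (a * ebar i) x y = (x == y) || [&& x != i, y != i & lower a x y].
Proof. by rewrite /lower same_block_mul_ebar. Qed.

Lemma upper_mul_tbar i j x y : upper (a * tbar i j) x y =
  [|| upper a x y, across a x i && across a y j | across a x j && across a y i].
Proof.
rewrite /upper same_block_mul_tbar; congr [|| _, _ && _ | _ && _];
  exact: same_block_sym.
Qed.

Lemma across_mul_tbar i j x y : across (a * tbar i j) x y =
  [|| across a x y, across a x i && lower a j y | across a x j && lower a i y].
Proof. exact: same_block_mul_tbar. Qed.

Lemma lower_mul_tbar i j x y : lower (a * tbar i j) x y =
  [|| lower a x y, lower a x i && lower a j y | lower a x j && lower a i y].
Proof. exact: same_block_mul_tbar. Qed.

End MulGenerators.

Section Closure.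
Variables (n : nat) (M : monoidType) (e : 'I_n -> M) (t : 'I_n -> 'I_n -> M).
Hypothesis H : partition_relations e t.
Implicit Types (r : rel 'I_n) (A B : {set 'I_n}) (x y z c : 'I_n) (p q : seq 'I_n)
  (a b : pmon n).

Definition has_normal_form a (m : M) := exists A x p,
  [/\ x \in A, transversal_rep a A (slide_perm x p) & m = normal_form e t a A x p].

Lemma has_normal_form_unique a (m m' : M) :
  has_normal_form a m -> has_normal_form a m' -> m = m'.
Proof.
move=> [A [x [p [xA repA ->]]]] [B [y [q [yB repB ->]]]].
exact: normal_form_eq.
Qed.

(** If i' is not alone among the lower points of its block, the representative is
kept away from i'; then e_i only removes i from the lower relation, by R8.  If
it is alone, e_i commutes with the lower part and cuts the line ending at i'. *)
Lemma has_normal_form_mul_e a m i :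
  has_normal_form a m -> has_normal_form (a * ebar i) (m * e i).
Proof.
move=> [A [x [p [xA repA ->]]]] {m}.
have [/existsP[j /andP[ji ij]]|lone] := boolP [exists j, (j != i) && lower a i j].
  have [s reps iA] := transversal_rep_avoid repA ji ij.
  have [q qs] := slide_perm_surj x s; rewrite -qs in reps iA.
  have -> : normal_form e t a A x p = normal_form e t a A x q.
    exact: (normal_form_eq H).
  exists A, x, q; split=> //.
    split.
    - move=> z zA; rewrite across_mul_ebar (rep_across reps zA) andbT.
      by apply: contraNneq zA => zi; rewrite -zi permK in iA.
    - move=> z y; rewrite across_mul_ebar => /andP[_ /(rep_cover reps)[w wA zw]].
      by exists w; rewrite ?upper_mul_ebar.
    by move=> z y zA yA; rewrite upper_mul_ebar; apply: (rep_inj reps).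
  set a' := a * ebar i; rewrite /normal_form (eq_glue_all t (upper_mul_ebar a i)).
  have fe : slide e t x q * e i = e ((slide_perm x q)^-1 i) * slide e t x q.
    by rewrite (e_slide H) permKV.
  have cutf : cut e A * slide e t x q * e i = cut e A * slide e t x q.
    by rewrite -mulgA fe mulgA (cut_e H).
  have ei : commute (e i) (glue_all t (lower a')).
    apply: commute_glue_all => y z; rewrite lower_mul_ebar.
    case: (eqVneq y z) => [->|_] /=; first by rewrite (rel_t1 H) => _; apply: commute1.
    by case/and3P=> yi zi _; rewrite /commute (rel_te H) // eq_sym.
  have low : glue_all t (lower a) = glue_all t (lower a') * t i j.
    apply: (glue_all_isolate H (lower_sym a) _ ij ji); last exact: lower_mul_ebar.
    exact: lower_trans.
  (* As A contains the preimage of i, a factor e i can be inserted to the left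
     of t i j e i, where it meets e i t i j e i. *)
  rewrite low -!mulgA; congr (_ * _); rewrite !mulgA -{1}cutf.
  rewrite -(mulgA _ (e i)) ei !mulgA -(mulgA _ (e i)) -(mulgA _ (_ * _) (e i)).
  by rewrite (rel_ete H) 1?eq_sym // -mulgA -ei mulgA cutf.
set l := (slide_perm x p)^-1 i.
have alone z : lower a i z -> z = i.
  move=> iz; apply: contraNeq lone => zi; apply/existsP; exists z.
  by rewrite zi.
exists (l |: A), x, p; split; first exact: setU1r.
  split.
  - move=> z; rewrite in_setU1 negb_or => /andP[zl zA].
    rewrite across_mul_ebar (rep_across repA zA) andbT.
    by apply: contraNneq zl => zi; rewrite /l -zi permK.
  - move=> z y; rewrite across_mul_ebar => /andP[yi zy].
    have [w wA zw] := rep_cover repA zy; exists w; last by rewrite upper_mul_ebar.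
    rewrite in_setU1 negb_or wA andbT; apply: contra yi => /eqP wl.
    apply/eqP/alone; have := rep_across repA wA; rewrite wl permKV => li.
    by apply: across_lower2 li _; rewrite upper_sym wl in zw; apply: upper_across zy.
  move=> z y; rewrite !in_setU1 !negb_or => /andP[_ zA] /andP[_ yA].
  by rewrite upper_mul_ebar; apply: (rep_inj repA).
rewrite /normal_form (eq_glue_all t (upper_mul_ebar a i)).
have -> : glue_all t (lower (a * ebar i)) = glue_all t (lower a).
  apply: eq_glue_all => y z; rewrite lower_mul_ebar.
  have [->|yz] /= := eqVneq y z; first by rewrite lower_refl.
  apply/idP/idP => [/and3P[]//|yz']; rewrite yz' andbT; apply/andP; split.
    by apply: contraNneq yz => eyi; rewrite eyi in yz' *; rewrite (alone _ yz').
  apply: contraNneq yz => ezi; rewrite ezi lower_sym in yz' *.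
  by rewrite (alone _ yz').
have ei : commute (e i) (glue_all t (lower a)).
  apply: commute_glue_all => y z yz; have [->|nyz] := eqVneq y z.
    by rewrite (rel_t1 H); apply: commute1.
  rewrite /commute (rel_te H) //; apply: contraNneq nyz => eiy.
    by rewrite -eiy in yz *; rewrite (alone _ yz).
  by rewrite -eiy lower_sym in yz *; rewrite (alone _ yz).
rewrite -(mulgA _ _ (e i)) -ei !mulgA -(mulgA _ (slide _ _ _ _)).
rewrite -{1}[i](permKV (slide_perm x p)) -/l -(e_slide H) -(e_cut H) !mulgA.
congr (_ * _ * _); rewrite -!mulgA; congr (_ * _).
by apply/commute_sym/cutC => *; apply: (rel_eC H).
Qed.

(** The upper relation changes only when t_ij merges two transversal blocks with
representatives y and z.  In this case t_ij absorbs t (s y) (s z), which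
commutes past the lines to become t y z, and one of the two lines is then
redundant by R7: it is removed by adding y to A. *)
Lemma has_normal_form_mul_t a m i j :
  has_normal_form a m -> has_normal_form (a * tbar i j) (m * t i j).
Proof.
move=> [A [x [p [xA repA ->]]]] {m}.
have low : glue_all t (lower (a * tbar i j)) = glue_all t (lower a) * t i j.
  by apply: (glue_all_join H) (lower_refl a) (lower_sym a) (lower_mul_tbar a i j).
set s := slide_perm x p in repA.
have acr y z : across (a * tbar i j) y z -> exists2 w, w \notin A & upper a y w.
  rewrite across_mul_tbar => /or3P[|/andP[+ _]|/andP[+ _]]; exact: (rep_cover repA).
have acr' z : z \notin A -> across (a * tbar i j) z (s z).
  by move=> zA; rewrite across_mul_tbar (rep_across repA zA).
have up z y : upper a z y -> upper (a * tbar i j) z y.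
  by rewrite upper_mul_tbar => ->.
have [/existsP[y /existsP[z]]|none] := boolP [exists y, exists z,
    [&& y \notin A, z \notin A, across a y i, across a z j & y != z]].
  case/and5P=> yA zA yi zj yz.
  have upE u v : upper (a * tbar i j) u v =
      [|| upper a u v, upper a u y && upper a z v | upper a u z && upper a y v].
    have acri w : across a w i = upper a w y.
      by apply/idP/idP => [ui|uy]; [apply: across_upper ui yi | apply: upper_across uy yi].
    have acrj w : across a w j = upper a w z.
      by apply/idP/idP => [ui|uy]; [apply: across_upper ui zj | apply: upper_across uy zj].
    by rewrite upper_mul_tbar !acri !acrj (upper_sym a z) (upper_sym a y).
  have upp : glue_all t (upper (a * tbar i j)) = glue_all t (upper a) * t y z.
    by apply: (glue_all_join H) (upper_refl a) (upper_sym a) upE.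
  exists (y |: A), x, p; split; first exact: setU1r.
    split.
    - by move=> u; rewrite in_setU1 negb_or => /andP[_]; apply: acr'.
    - move=> u v /acr[w wA uw]; have [ewy|wy] := eqVneq w y; last first.
        by exists w; [rewrite in_setU1 negb_or wy | apply: up].
      exists z; first by rewrite in_setU1 negb_or eq_sym yz.
      by rewrite upE -ewy uw upper_refl orbT.
    move=> u v; rewrite !in_setU1 !negb_or => /andP[uy uA] /andP[vy vA].
    rewrite upE => /or3P[|/andP[/(rep_inj repA) h _]|/andP[_ /(rep_inj repA) h]].
    - exact: (rep_inj repA).
    - by rewrite h ?eqxx in uy.
    by rewrite -h ?eqxx in vy.
  rewrite /normal_form upp low.
  have syz : lower (a * tbar i j) (s y) (s z).
    rewrite lower_mul_tbar; apply/or3P/Or32.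
    by rewrite (across_lower2 (rep_across repA yA) yi) (across_lower2 zj (rep_across repA zA)).
  have tf : t y z * (cut e A * slide e t x p) =
      cut e A * slide e t x p * t (s y) (s z).
    have -> : t y z * (cut e A * slide e t x p) = cut e A * (t y z * slide e t x p).
      rewrite !mulgA; congr (_ * _); apply: cutC => k kA.
      by apply: (rel_te H); apply: contraTneq kA => ->.
    by rewrite (t_slide H) ?mulgA //; [apply: contraNneq yA => -> | apply: contraNneq zA => ->].
  have lowE : glue_all t (lower (a * tbar i j)) =
      t (s y) (s z) * glue_all t (lower (a * tbar i j)).
    by rewrite (t_glue_allC H) (glue_all_absorb H syz).
  have insert (u f v : M) : t y z * f * v = f * v ->
      u * f * v = u * t y z * (e y * f) * v.
    move=> fv; rewrite -!mulgA; congr (_ * _).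
    by rewrite -{1}fv -{1}(rel_tet H yz) -!mulgA (mulgA _ f) fv.
  rewrite -mulgA -low -(e_cut H) -(mulgA (e y)); apply: insert.
  by rewrite tf -(mulgA (_ * _) (t _ _)) -lowE.
have upE : glue_all t (upper (a * tbar i j)) = glue_all t (upper a).
  apply: eq_glue_all => y z; rewrite upper_mul_tbar.
  apply: orb_idr; suff mix u v : across a u i -> across a v j -> upper a u v.
    by case/orP=> /andP[yi zj]; [apply: mix | rewrite upper_sym; apply: mix].
  move=> ui vj; have [w wA uw] := rep_cover repA ui.
  have [w' wA' vw] := rep_cover repA vj; rewrite upper_sym in uw.
  have [eww|ww] := eqVneq w w'.
    by rewrite upper_sym in uw; apply: upper_trans uw _; rewrite eww upper_sym.
  case/negP: none; apply/existsP; exists w; apply/existsP; exists w'.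
  rewrite wA wA' ww (upper_across uw ui) /= andbT.
  by rewrite upper_sym in vw; apply: upper_across vw vj.
exists A, x, p; split=> //; last by rewrite /normal_form low upE !mulgA.
split; first exact: acr'.
  by move=> y z /acr[w wA yw]; exists w => //; apply: up.
move=> y z yA zA; rewrite upper_mul_tbar => /or3P[|/andP[yi zj]|/andP[yj zi]].
- exact: (rep_inj repA).
- apply: contraNeq none => yz; apply/existsP; exists y; apply/existsP; exists z.
  by rewrite yA zA yi zj.
- apply: contraNeq none => yz; apply/existsP; exists z; apply/existsP; exists y.
  by rewrite yA zA zi yj eq_sym.
Qed.

Lemma glue_all_trivial r : (forall x y, r x y -> x = y) -> glue_all t r = 1.
Proof. by move=> rE; apply: big1 => -[x y] /= /rE->; apply: (rel_t1 H). Qed.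

Lemma has_normal_form_e i : has_normal_form (ebar i) (e i).
Proof.
have upE x y : upper (ebar i) x y -> x = y.
  by rewrite /upper same_block_ebar => /orP[/eqP[]|/andP[/eqP]].
exists [set i], i, [::]; split; first exact: set11.
  split=> [x|x y|x y _ _ /upE //]; first rewrite inE.
    by rewrite /across same_block_ebar /= perm1 eqxx.
  rewrite /across same_block_ebar /= => /andP[_ xi].
  by exists x; rewrite ?inE ?upper_refl.
rewrite /normal_form !glue_all_trivial //; last first.
  by move=> x y; rewrite /lower same_block_ebar => /orP[/eqP[]|/andP[/eqP]].
by rewrite mul1g mulg1 /cut big_set1 /= (rel_ee H).
Qed.

(** The product t e_i t given by R7 is a normal form. *)
Lemma has_normal_form_t i j : i != j -> has_normal_form (tbar i j) (t i j).
Proof.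
move=> ij; have glueE r : (forall x y, r x y = (x == y) || (x \in [set i; j]) && (y \in [set i; j])) ->
    glue_all t r = t i j.
  move=> rE; rewrite (@glue_all_join _ _ _ _ H eq_op r i j) //.
  - by rewrite glue_all_trivial ?mul1g // => x y /eqP.
  move=> x y; rewrite rE !inE (eq_sym j y) (eq_sym i y).
  have [//|xy] /= := eqVneq x y; have yx : (y == x) = false by rewrite eq_sym (negPf xy).
  by have [<-|_] := eqVneq x i; have [<-|_] := eqVneq x j; rewrite ?yx ?andbF ?orbF.
exists [set i], i, [::]; split; first exact: set11.
  split=> [x|x y|x y].
  - by rewrite inE /across same_block_tbar /= perm1 eqxx.
  - have [->|xi] := eqVneq x i; last by exists x; rewrite ?inE ?upper_refl.
    exists j; first by rewrite inE eq_sym.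
    by rewrite /upper same_block_tbar /= !inE !eqxx !orbT.
  rewrite !inE /upper same_block_tbar /= !inE => /negPf-> /negPf->.
  by rewrite /= => /orP[/eqP//|/andP[/eqP-> /eqP->]].
rewrite /normal_form !glueE; first by rewrite /cut big_set1 /= (rel_ee H) (rel_tet H).
  by move=> x y; rewrite /lower same_block_tbar.
by move=> x y; rewrite /upper same_block_tbar.
Qed.

End Closure.

(** * The relations hold among partitions *)

(* From here on blocks are known only through the lemmas above. *)
#[local] Opaque ebar tbar pmul same_block.

Section PartitionMonoid.
Variable n : nat.
Implicit Types (a b c : pmon n) (i j k x y z : 'I_n) (p q : vertex n) (s : seq 'I_n).

Lemma same_block_label a p q : label p = label q -> same_block (1 : pmon n) p q.
Proof. by move=> pq; rewrite same_block_one; apply/eqP. Qed.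

Lemma sub_mul_tbar a i j p q : same_block a p q -> same_block (a * tbar i j) p q.
Proof. by rewrite same_block_mul_tbar => ->. Qed.

Lemma mul_tbar_glues a i j : lower (a * tbar i j) i j.
Proof. by rewrite lower_mul_tbar !lower_refl orbT. Qed.

Lemma mul_tbar_least a i j (R : rel (vertex n)) :
    symmetric R -> transitive R -> R (inr i) (inr j) ->
    (forall p q, same_block a p q -> R p q) ->
  forall p q, same_block (a * tbar i j) p q -> R p q.
Proof.
move=> Rs Rt Rij aR p q; rewrite same_block_mul_tbar.
case/or3P=> [/aR //|/andP[/aR pi /aR jq]|/andP[/aR pj /aR iq]].
  exact: Rt pi (Rt _ _ _ Rij jq).
by apply: Rt pj (Rt _ _ _ _ iq); rewrite Rs.
Qed.

Lemma mul_tbar_sub a c i j : lower c i j ->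
    (forall p q, same_block a p q -> same_block c p q) ->
  forall p q, same_block (a * tbar i j) p q -> same_block c p q.
Proof.
apply: mul_tbar_least; [exact: same_block_sym | exact: same_block_trans].
Qed.

Lemma mul_ebar_sub a i p q : same_block (a * ebar i) p q -> same_block a p q.
Proof.
by rewrite same_block_mul_ebar => /orP[/eqP->|/and3P[]//]; apply: same_block_refl.
Qed.

Lemma pmon_eqP b c :
    (forall a p q, same_block (a * b) p q -> same_block (a * c) p q) ->
    (forall a p q, same_block (a * c) p q -> same_block (a * b) p q) ->
  b = c.
Proof.
move=> bc cb; rewrite -[b]mul1g -[c]mul1g; apply: pmon_ext => p q.
by apply/idP/idP; [apply: bc | apply: cb].
Qed.

Lemma ebar_idem i : ebar i * ebar i = ebar i.
Proof.
rewrite -[LHS]mul1g -[RHS]mul1g mulgA; apply: pmon_ext => p q.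
by rewrite !same_block_mul_ebar; case: (p == q); case: (p != _); case: (q != _).
Qed.

Lemma ebarC i j : ebar i * ebar j = ebar j * ebar i.
Proof.
rewrite -[LHS]mul1g -[RHS]mul1g !mulgA; apply: pmon_ext => p q.
rewrite !same_block_mul_ebar; case: (p == q) => //=.
by case: (p != inr i); case: (q != inr i); case: (p != inr j); case: (q != inr j).
Qed.

Lemma tbar_diag i : tbar i i = 1.
Proof.
apply: pmon_ext => p q; rewrite same_block_tbar same_block_one -/(label p) -/(label q).
by apply: orb_idr; rewrite !inE !orbb => /andP[/eqP-> /eqP->].
Qed.

Lemma tbar_idem i j : tbar i j * tbar i j = tbar i j.
Proof.
apply: pmon_eqP => a p q; rewrite mulgA; last exact: sub_mul_tbar.
by apply: mul_tbar_sub => //; apply: mul_tbar_glues.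
Qed.

Lemma tbar_comm i j k l : tbar i j * tbar k l = tbar k l * tbar i j.
Proof.
suff h i' j' k' l' a p q : same_block (a * (tbar i' j' * tbar k' l')) p q ->
    same_block (a * (tbar k' l' * tbar i' j')) p q.
  by apply: pmon_eqP => a p q; apply: h.
rewrite !mulgA; apply: mul_tbar_sub; first exact/sub_mul_tbar/mul_tbar_glues.
apply: mul_tbar_sub; first exact: mul_tbar_glues.
by move=> u v uv; do 2!apply: sub_mul_tbar.
Qed.

Lemma tbar_triangle i j k : tbar i j * tbar j k = tbar j k * tbar k i.
Proof.
apply: pmon_eqP => a p q; rewrite !mulgA; set c := (X in _ -> same_block X _ _).
- have jk : lower c j k by exact/sub_mul_tbar/mul_tbar_glues.
  have ki : lower c k i by exact: mul_tbar_glues.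
  have ij : lower c i j by rewrite lower_sym; exact: lower_trans jk ki.
  apply: (mul_tbar_sub jk); apply: (mul_tbar_sub ij).
  by move=> u v uv; do 2!apply: sub_mul_tbar.
have ij : lower c i j by exact/sub_mul_tbar/mul_tbar_glues.
have jk : lower c j k by exact: mul_tbar_glues.
have ki : lower c k i by rewrite lower_sym; exact: lower_trans ij jk.
apply: (mul_tbar_sub ki); apply: (mul_tbar_sub jk).
by move=> u v uv; do 2!apply: sub_mul_tbar.
Qed.

Lemma tbar_ebar_comm i j k : k != i -> k != j -> tbar i j * ebar k = ebar k * tbar i j.
Proof.
move=> ki kj; rewrite -[LHS]mul1g -[RHS]mul1g !mulgA; apply: pmon_ext => p q.
rewrite (same_block_mul_ebar (1 * _)) (same_block_mul_tbar 1 i j p q).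
rewrite (same_block_mul_tbar (1 * ebar k)) !same_block_mul_ebar.
have neq l : k != l -> (inr l != inr k :> vertex n) = true.
  by rewrite eq_sym => kl; apply: contra kl => /eqP[->].
have cutr l : k != l -> (p == inr l) || [&& p != inr k, inr l != inr k & same_block (1 : pmon n) p (inr l)]
   = (p != inr k) && same_block (1 : pmon n) p (inr l).
  by move=> kl; rewrite (neq l kl) andTb; apply: orb_idl => /eqP->; rewrite neq // same_block_refl.
have cutl l : k != l -> (inr l == q) || [&& inr l != inr k, q != inr k & same_block (1 : pmon n) (inr l) q]
   = (q != inr k) && same_block (1 : pmon n) (inr l) q.
  by move=> kl; rewrite (neq l kl) andTb; apply: orb_idl => /eqP<-; rewrite neq // same_block_refl.
rewrite !cutr // !cutl //; have [//|_] /= := eqVneq p q.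
by case: (p != inr k); case: (q != inr k); rewrite ?andbF.
Qed.

Lemma tbar_ebar_tbar i j : i != j -> tbar i j * ebar i * tbar i j = tbar i j.
Proof.
move=> ij; apply: pmon_eqP => a p q; rewrite !mulgA.
  apply: mul_tbar_sub; first exact: mul_tbar_glues.
  by move=> u v; apply: mul_ebar_sub.
set b := a * tbar i j; set c := b * ebar i * _.
have bij : lower b i j by apply: mul_tbar_glues.
have cij : lower c i j by apply: mul_tbar_glues.
have away u v : u != inr i -> v != inr i -> same_block b u v -> same_block c u v.
  by move=> ui vi uv; apply: sub_mul_tbar; rewrite same_block_mul_ebar ui vi uv orbT.
have ji : inr j != inr i :> vertex n by apply: contra ij => /eqP[->].
have at_i v : same_block b (inr i) v -> same_block c (inr i) v.
  move=> iv; have [->|vi] := eqVneq v (inr i); first exact: same_block_refl.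
  apply: same_block_trans cij (away _ _ ji vi _).
  by apply: same_block_trans iv; rewrite same_block_sym.
move=> pq; have [ep|pi] := eqVneq p (inr i); first by rewrite ep in pq *; apply: at_i.
have [eq|qi] := eqVneq q (inr i); last exact: away.
by rewrite eq in pq *; rewrite same_block_sym; apply: at_i; rewrite same_block_sym.
Qed.

Lemma ebar_tbar_ebar i j : i != j -> ebar i * tbar i j * ebar i = ebar i.
Proof.
move=> ij; rewrite -[LHS]mul1g -[RHS]mul1g !mulgA; apply: pmon_ext => p q.
rewrite same_block_mul_ebar same_block_mul_tbar !same_block_mul_ebar eqxx /=.
have [//|pq] /= := eqVneq p q.
have [//|pi] /= := eqVneq p (inr i); have [//|qi] /= := eqVneq q (inr i).
by rewrite andbF orbF.
Qed.

Definition relabel (s : {perm 'I_n}) p : vertex n :=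
  match p with inl x => inl x | inr x => inr (s x) end.

Lemma same_block_slide1 a i j p q :
  same_block (a * slide1 (@ebar n) (@tbar n) i j) p q =
  same_block (a * ebar i) (relabel (tperm i j) p) (relabel (tperm i j) q).
Proof.
have bi u : same_block (a * ebar i) (inr i) u = (inr i == u).
  by rewrite same_block_mul_ebar eqxx orbF.
rewrite /slide1; have [<-|ij] := eqVneq i j.
  rewrite tbar_diag mulg1 ebar_idem tperm1; congr (same_block _ _ _).
    by case: p => x //=; rewrite perm1.
  by case: q => x //=; rewrite perm1.
have [->|pq] := eqVneq p q; first by rewrite !same_block_refl.
have ji : inr j != inr i :> vertex n by apply: contra ij => /eqP[->].
have jin : (inr i == inr j :> vertex n) = false by rewrite eq_sym (negPf ji).
have relD u : u != inr i -> u != inr j -> relabel (tperm i j) u = u.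
  case: u => //= x xi xj; rewrite tpermD //.
    by apply: contra xi => /eqP->.
  by apply: contra xj => /eqP->.
rewrite !mulgA; move: (a * ebar i) bi => b bi.
rewrite same_block_mul_ebar same_block_mul_tbar (negPf pq) /=.
have bi' u : same_block b u (inr i) = (inr i == u) by rewrite same_block_sym.
have [pj|pj] /= := eqVneq p (inr j).
  rewrite pj /= tpermR bi; apply/esym/negbTE; apply: contra pq => /eqP.
  rewrite pj; case: q => x //= [] ix; apply/eqP; congr inr.
  by rewrite -[x](tpermK i j) -ix tpermL.
have [qj|qj] /= := eqVneq q (inr j).
  rewrite qj /= tpermR bi'; apply/esym/negbTE; apply: contra pq => /eqP.
  rewrite qj; case: p {pj} => x //= [] ix; apply/eqP; congr inr.
  by rewrite -[x](tpermK i j) -ix tpermL.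
rewrite !bi !bi'.
have [pi|pi] /= := eqVneq p (inr i).
  have qi : q != inr i by rewrite -pi eq_sym.
  by rewrite pi /= tpermL bi (relD q) // [inr i == q]eq_sym (negPf qi) ?eqxx ?andbF ?orbF.
have [qi|qi] /= := eqVneq q (inr i).
  by rewrite qi /= tpermL (relD p) // bi' [inr i == p]eq_sym (negPf pi) /= ?eqxx ?andbT.
by rewrite ?andbF ?orbF !relD.
Qed.

(** A slide acts on partitions as a genuine permutation of the lower points, once
the hole is cut off.  Hence R9 and R10 reduce to identities between products of
transpositions. *)
Lemma same_block_slide a i s p q :
  same_block (a * slide (@ebar n) (@tbar n) i s) p q =
  same_block (a * ebar i) (relabel (slide_perm i s)^-1 p) (relabel (slide_perm i s)^-1 q).
Proof.
elim: s a i p q => [|j s IHs] a i p q /=.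
  by rewrite invg1; congr (same_block _ _ _); case: (p) (q) => x [] y //=; rewrite ?perm1.
rewrite mulgA IHs -mulgA (mul_slide1_e _ ebar_idem) same_block_slide1 invMg tpermV.
by congr (same_block _ _ _); case: (p) (q) => x [] y //=; rewrite ?permM.
Qed.

Lemma slide_bar_eq i s s' : slide_perm i s = slide_perm i s' ->
  slide (@ebar n) (@tbar n) i s = slide (@ebar n) (@tbar n) i s'.
Proof.
move=> ss; rewrite -[LHS]mul1g -[RHS]mul1g; apply: pmon_ext => p q.
transitivity (same_block (1 * ebar i) (relabel (slide_perm i s)^-1 p)
  (relabel (slide_perm i s)^-1 q)); first exact: same_block_slide.
by rewrite ss; symmetry; exact: same_block_slide.
Qed.

Lemma pmon_relations : partition_relations (@ebar n) (@tbar n).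
Proof.
split.
- exact: ebar_idem.
- exact: ebarC.
- exact: tbar_diag.
- exact: tbarC.
- exact: tbar_idem.
- exact: tbar_comm.
- exact: tbar_triangle.
- exact: tbar_ebar_comm.
- exact: tbar_ebar_tbar.
- exact: ebar_tbar_ebar.
- move=> i j k ij jk ki; rewrite -!(slide3E _ ebar_idem); apply: slide_bar_eq.
  by rewrite !slide_perm_triangle 1?tpermC // eq_sym.
move=> i j k l ki ij jl lk li jk; rewrite -!(slide4E _ ebar_idem).
by apply/slide_bar_eq/slide_perm_square; rewrite // eq_sym.
Qed.

End PartitionMonoid.

(** * Surjectivity *)

Section Surjectivity.
Variable n : nat.
Implicit Types (a b c m : pmon n) (i j k x y z : 'I_n) (p q : vertex n) (A : {set 'I_n}).

Notation glue_all := (glue_all (@tbar n)).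
Notation cut := (cut (@ebar n)).
Notation slide := (slide (@ebar n) (@tbar n)).

Lemma glue_all_extends (r : rel 'I_n) a p q :
  same_block a p q -> same_block (a * glue_all r) p q.
Proof.
move: a; apply: (big_ind (fun m => forall a, same_block a p q -> same_block (a * m) p q)).
- by move=> b; rewrite mulg1.
- by move=> m m' mP mP' b ab; rewrite mulgA; apply/mP'/mP.
by move=> [i j] _ b; apply: sub_mul_tbar.
Qed.

Lemma glue_all_glues (r : rel 'I_n) a x y : r x y -> lower (a * glue_all r) x y.
Proof.
move=> rxy; rewrite -(glue_all_absorb (pmon_relations n) rxy) mulgA.
exact: mul_tbar_glues.
Qed.

Lemma glue_all_least (r : rel 'I_n) a (R : rel (vertex n)) :
    symmetric R -> transitive R -> (forall x y, r x y -> R (inr x) (inr y)) ->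
    (forall p q, same_block a p q -> R p q) ->
  forall p q, same_block (a * glue_all r) p q -> R p q.
Proof.
move=> Rs Rt rR; move: a.
apply: (big_ind (fun m => forall a, (forall p q, same_block a p q -> R p q) ->
  forall p q, same_block (a * m) p q -> R p q)).
- by move=> b; rewrite mulg1.
- by move=> m m' mP mP' b ab; rewrite mulgA; apply/mP'/mP.
by move=> [i j] /= /rR ij b ab; apply: mul_tbar_least.
Qed.

Lemma cut_sub A a p q : same_block (a * cut A) p q -> same_block a p q.
Proof.
move: a; apply: (big_ind (fun m => forall a, same_block (a * m) p q -> same_block a p q)).
- by move=> b; rewrite mulg1.
- by move=> m m' mP mP' b; rewrite mulgA => /mP'/mP.
by move=> i _ b; apply: mul_ebar_sub.
Qed.

Definition in_lower (A : {set 'I_n}) p := if p is inr x then x \in A else false.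

Lemma same_block_cut A a p q : same_block (a * cut A) p q =
  (p == q) || [&& ~~ in_lower A p, ~~ in_lower A q & same_block a p q].
Proof.
apply/idP/orP => [pq|[/eqP->|/and3P[pA qA ab]]]; last first.
- move: a ab; apply: (big_ind (fun m => forall a, same_block a p q -> same_block (a * m) p q)).
  + by move=> b; rewrite mulg1.
  + by move=> m m' mP mP' b ab; rewrite mulgA; apply/mP'/mP.
  move=> i iA b ab; rewrite same_block_mul_ebar ab andbT; apply/orP; right.
  by apply/andP; split; [apply: contra pA | apply: contra qA] => /eqP->.
- exact: same_block_refl.
have alone u v : same_block (a * cut A) u v -> in_lower A u -> u = v.
  case: u => // i uv /= iA; move: uv.
  rewrite -(cut_e (pmon_relations n) iA) mulgA same_block_mul_ebar.
  by rewrite eqxx orbF => /eqP.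
have [pA|pA] := boolP (in_lower A p); first by left; apply/eqP/alone.
have [qA|qA] := boolP (in_lower A q); last by right; apply: cut_sub pq.
by left; rewrite eq_sym; apply/eqP/alone => //; rewrite same_block_sym.
Qed.

Lemma same_block_glue_all a p q :
  same_block (glue_all (upper a)) p q = upper a (label p) (label q).
Proof.
rewrite -[glue_all _]mul1g; apply/idP/idP.
  apply: (glue_all_least (R := fun u v => upper a (label u) (label v))) => //.
  - by move=> u v; apply: upper_sym.
  - by move=> v u w; apply: upper_trans.
  move=> u v; rewrite same_block_one => /eqP uv.
  by rewrite /label uv upper_refl.
have J u : same_block (1 * glue_all (upper a)) u (inr (label u)).
  by apply/glue_all_extends/same_block_label.
move=> pq; apply: same_block_trans (J p) _; rewrite same_block_sym.
apply: same_block_trans (J q) _; rewrite same_block_sym.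
exact: glue_all_glues.
Qed.

(** Read from left to right on partitions: the first factor glues upper blocks,
the cut keeps one lower point per transversal block, the slides send it to its
end point, and the last factor glues lower blocks. *)
Lemma normal_formK a A x (s : seq 'I_n) :
    x \in A -> transversal_rep a A (slide_perm x s) ->
  normal_form (@ebar n) (@tbar n) a A x s = a.
Proof.
move=> xA repA; set g := slide_perm x s in repA; rewrite /normal_form.
set c := _ * (_ * _).
have cE p q : same_block c p q = (p == q) ||
    [&& ~~ in_lower A (relabel g^-1 p), ~~ in_lower A (relabel g^-1 q)
      & upper a (label (relabel g^-1 p)) (label (relabel g^-1 q))].
  rewrite /c mulgA same_block_slide -mulgA (cut_e (pmon_relations n) xA).
  rewrite same_block_cut same_block_glue_all; congr (_ || _).
  apply/eqP/eqP => [|->//].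
  by case: p q => p [] q //= [] // /perm_inj->.
apply: pmon_ext => p q; apply/idP/idP.
  apply: glue_all_least => //; [exact: same_block_sym | exact: same_block_trans |].
  move=> {}p {}q; rewrite cE => /orP[/eqP->|/and3P[pA qA pq]].
    exact: same_block_refl.
  have top u : ~~ in_lower A (relabel g^-1 u) ->
      same_block a u (inl (label (relabel g^-1 u))).
    case: u => y /= yA; first exact: same_block_refl.
    by rewrite same_block_sym; have := rep_across repA yA; rewrite permKV.
  apply: same_block_trans (top p pA) _; rewrite same_block_sym.
  by apply: same_block_trans (top q qA) _; rewrite same_block_sym.
have edge y z : across a y z -> same_block (c * glue_all (lower a)) (inl y) (inr z).
  move=> yz; have [w wA yw] := rep_cover repA yz.
  apply: (@same_block_trans _ _ (inr (g w))).
    by apply: glue_all_extends; rewrite cE /= permK wA yw.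
  apply: glue_all_glues; apply: across_lower2 (rep_across repA wA) _.
  by rewrite upper_sym in yw; apply: upper_across yz.
case: p q => y [] z yz.
- by apply: glue_all_extends; rewrite cE /=; apply/orP; right.
- exact: edge.
- by rewrite same_block_sym; apply: edge; rewrite /across same_block_sym.
exact: glue_all_glues.
Qed.

(** Boolean in A, so that a smallest A can be picked. *)
Definition partial_rep a A : bool := [exists g : {perm 'I_n},
  [forall x, (x \notin A) ==> across a x (g x)] &&
  [forall x, forall y, (x \notin A) && (y \notin A) && upper a x y ==> (x == y)]].

Lemma partial_repP a A :
  reflect (exists2 g : {perm 'I_n}, forall x, x \notin A -> across a x (g x) &
    forall x y, x \notin A -> y \notin A -> upper a x y -> x = y) (partial_rep a A).
Proof.
apply: (iffP existsP) => [[g /andP[/forallP gA /forallP inj]]|[g gA inj]]; exists g.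
- by move=> x; apply/implyP.
- move=> x y xA yA xy; apply/eqP; have /forallP/(_ y)/implyP := inj x.
  by apply; rewrite xA yA.
apply/andP; split; apply/forallP => x; first exact/implyP/gA.
by apply/forallP => y; apply/implyP => /andP[/andP[xA yA] xy]; apply/eqP/inj.
Qed.

(** A partial choice of representatives with largest domain reaches every
transversal block: otherwise the missing line can be added.  If its domain were
everything, all n upper points would lie in distinct transversal blocks. *)
Lemma transversal_rep_exists a : rank a < n ->
  exists A g x, x \in A /\ transversal_rep a A g.
Proof.
move=> an; have : partial_rep a setT.
  by apply/partial_repP; exists 1 => [x|x y]; rewrite inE.
case/(arg_minnP (fun A : {set 'I_n} => #|A|)) => A /partial_repP[g gA inj] minA.
have rep : transversal_rep a A g.
  split=> // x y xy; have [/existsP[z /andP[]]|none] := boolP [exists z, (z \notin A) && upper a x z].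
    by exists z.
  have noz z : z \notin A -> ~~ upper a x z.
    by move=> zA; apply: contra none => xz; apply/existsP; exists z; rewrite zA.
  have xA : x \in A by apply: contraT => /noz; rewrite upper_refl.
  have yA z : z \notin A -> g z != y.
    move=> zA; apply: contra (noz z zA) => /eqP gz.
    by apply: across_upper xy _; rewrite -gz; apply: gA.
  suff /minA : partial_rep a (A :\ x) by rewrite [#|A|](cardsD1 x) xA ltnn.
  have nAx z : (z \notin A :\ x) = (z == x) || (z \notin A) by rewrite !inE negb_and negbK.
  apply/partial_repP; exists (g * tperm (g x) y).
    move=> z; rewrite nAx permM => /orP[/eqP->|zA]; first by rewrite tpermL.
    rewrite tpermD; first exact: gA.
      by rewrite (inj_eq perm_inj); apply: contraNneq zA => <-.
    by rewrite eq_sym yA.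
  move=> z w; rewrite !nAx => /orP[/eqP->|zA] /orP[/eqP->|wA] //.
  - by move=> xw; case/negP: (noz w wA).
  - by rewrite upper_sym => xz; case/negP: (noz z zA).
  exact: inj.
have [A0|[x xA]] := set_0Vmem A; last by exists A, g, x.
have nA x : x \notin A by rewrite A0 inE.
suff : n <= rank a by rewrite leqNgt an.
have bl x : same_block a (inl x) (inr (g x)) by apply: gA.
rewrite -[X in X <= _]card_ord -(card_imset (f := fun x : 'I_n => pblock a (inl x)) predT).
  apply/subset_leq_card/subsetP => B /imsetP[x _ ->]; rewrite inE.
  have /and3P[/eqP cov _ _] := blocks_partition a.
  rewrite pblock_mem ?cov ?inE //=; apply/andP; split; apply/existsP.
    by exists x; rewrite -same_block_pblock same_block_refl.
  by exists (g x); rewrite -same_block_pblock.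
move=> x y xy; apply: inj => //; rewrite /upper same_block_pblock xy.
by rewrite -same_block_pblock same_block_refl.
Qed.

Definition expressible a := exists w, sing_val (phi n w) = a.

Lemma expressible_mul a b : expressible a -> expressible b -> expressible (a * b).
Proof. by move=> [u <-] [v <-]; exists (u * v); rewrite gmulfM. Qed.

Lemma expressible_e i : expressible (ebar i).
Proof. by exists (e_ i). Qed.

Lemma expressible_t i j : tbar i j = 1 \/ expressible (tbar i j).
Proof.
have [->|ij] := eqVneq i j; first by left; apply: tbar_diag.
by right; exists (t_ ij); rewrite phi_t.
Qed.

Lemma expressible1_mul a b :
  a = 1 \/ expressible a -> b = 1 \/ expressible b -> a * b = 1 \/ expressible (a * b).
Proof.
move=> [->|ea] [->|eb]; rewrite ?mul1g ?mulg1; [by left|by right|by right|right].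
exact: expressible_mul.
Qed.

Lemma expressible_slide x s : expressible (slide x s).
Proof.
elim: s x => [|y s IHs] x /=; first exact: expressible_e.
apply: expressible_mul => //; apply: expressible_mul; last exact: expressible_e.
have [->|h] := expressible_t x y; rewrite ?mulg1; first exact: expressible_e.
exact: expressible_mul (expressible_e x) h.
Qed.

Lemma phi_surjective (s : sing n) : exists w, phi n w = s.
Proof.
have [A [g [x [xA rep]]]] := transversal_rep_exists (sing_rank s).
have [u us] := slide_perm_surj x g.
rewrite -us in rep.
suff [w ws] : expressible s by exists w; apply: val_inj.
rewrite -(normal_formK xA rep).
have G r : glue_all r = 1 \/ expressible (glue_all r).
  apply: (big_ind (fun m => m = 1 \/ expressible m)); first by left.
    exact: expressible1_mul.
  by move=> [i j] _; apply: expressible_t.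
have C : cut A = 1 \/ expressible (cut A).
  apply: (big_ind (fun m => m = 1 \/ expressible m)); first by left.
    exact: expressible1_mul.
  by move=> i _; right; apply: expressible_e.
have F : expressible (cut A * slide x u).
  have [->|h] := C; rewrite ?mul1g; first exact: expressible_slide.
  exact: expressible_mul h (expressible_slide x u).
have [G1 G2] := (G (upper s), G (lower s)).
have F1 : expressible (glue_all (upper s) * (cut A * slide x u)).
  by case: G1 => [->|h]; rewrite ?mul1g //; apply: expressible_mul.
by rewrite /normal_form; case: G2 => [->|h]; rewrite ?mulg1 //; apply: expressible_mul.
Qed.

End Surjectivity.

(** * Words modulo the relations *)

Section PresentedMonoid.
Variables (X : choiceType) (R : fsg X -> fsg X -> Prop).

(** The congruence on non-empty words, extended to the free monoid by keeping the
empty word alone in its class; this supplies the unit used for t i i. *)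
Definition word_cong (u v : seq X) : Prop :=
  match u, v with
  | [::], [::] => True
  | x :: s, y :: s' => congruence_gen R (Fsg x s) (Fsg y s')
  | _, _ => False
  end.

Lemma word_cong_equiv : equiv_class_of (fun u v => `[< word_cong u v >]).
Proof.
split.
- by case=> [|x s]; apply/asboolP => //; apply: cong_refl.
- by move=> [|x s] [|y s']; apply: asbool_equiv_eq; split=> //; apply: cong_sym.
by move=> [|y s'] [|x s] [|z s''] /asboolP h1 /asboolP h2; apply/asboolP => //; apply: cong_trans h2.
Qed.

Canonical word_cong_equiv_rel := EquivRelPack word_cong_equiv.

Definition presented_monoid := {eq_quot word_cong_equiv_rel}.

HB.instance Definition _ := Choice.on presented_monoid.

Definition word_class (u : seq X) : presented_monoid := \pi_presented_monoid u.

Lemma word_classP u v : word_class u = word_class v <-> word_cong u v.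
Proof. by split=> [/eqmodP/asboolP|uv] //; apply/eqmodP/asboolP. Qed.

Lemma word_cong_cat u v u' v' :
  word_cong u v -> word_cong u' v' -> word_cong (u ++ u') (v ++ v').
Proof.
case: u v u' v' => [|x s] [|y s'] [|x' t] [|y' t'] //= h h'; rewrite ?cats0 //.
exact: (cong_mul h h').
Qed.

Definition presented_mul (a b : presented_monoid) := word_class (repr a ++ repr b).

Lemma word_class_repr a : word_class (repr a) = a.
Proof. exact: reprK. Qed.

Lemma word_class_cat u v : presented_mul (word_class u) (word_class v) = word_class (u ++ v).
Proof.
by apply/word_classP/word_cong_cat; apply/word_classP; rewrite word_class_repr.
Qed.

Lemma presented_mulA : associative presented_mul.
Proof.
move=> a b c; rewrite -(word_class_repr a) -(word_class_repr b) -(word_class_repr c).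
by rewrite !word_class_cat catA.
Qed.

Lemma presented_mul1 : left_id (word_class [::]) presented_mul.
Proof. by move=> a; rewrite -(word_class_repr a) word_class_cat. Qed.

Lemma presented_mulr1 : right_id (word_class [::]) presented_mul.
Proof. by move=> a; rewrite -(word_class_repr a) word_class_cat cats0. Qed.

HB.instance Definition _ :=
  isMonoid.Build presented_monoid presented_mulA presented_mul1 presented_mulr1.

Definition fsg_class (w : fsg X) : presented_monoid :=
  word_class (fsg_head w :: fsg_tail w).

Lemma fsg_classM u v : fsg_class (u * v) = fsg_class u * fsg_class v.
Proof. by rewrite /fsg_class [RHS]word_class_cat. Qed.

Lemma fsg_classP u v : fsg_class u = fsg_class v <-> congruence_gen R u v.
Proof. by case: u v => [x s] [y s']; apply: word_classP. Qed.

End PresentedMonoid.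

Section Kernel.
Variable n : nat.
Implicit Types i j k l : 'I_n.

Notation W := (presented_monoid (@rel_R n)).

Definition class_e i : W := fsg_class (@rel_R n) (e_ i).

Definition class_t i j : W :=
  if insub (if i < j then (i, j) else (j, i)) is Some p
  then fsg_class (@rel_R n) (fsg_letter (inr (p : T_index n))) else 1.

Lemma class_tE i j (ij : i != j) : class_t i j = fsg_class (@rel_R n) (t_ ij).
Proof.
rewrite /class_t; case: insubP => [p _ pE|]; last by case/negP; apply: T_index_subproof.
by congr (fsg_class _ (fsg_letter (inr _))); apply: val_inj.
Qed.

Lemma class_t1 i : class_t i i = 1.
Proof. by rewrite /class_t insubF ?ltnn //= ltnn. Qed.

Lemma class_t_sym i j : class_t i j = class_t j i.
Proof.
have [->//|ij] := eqVneq i j; have ji : j != i by rewrite eq_sym.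
by rewrite (class_tE ij) (class_tE ji) (t_sym ij ji).
Qed.

Lemma class_rel u v : rel_R u v -> fsg_class (@rel_R n) u = fsg_class (@rel_R n) v.
Proof. by move=> uv; apply/fsg_classP/cong_rel. Qed.

Lemma class_relations : partition_relations class_e class_t.
Proof.
split.
- by move=> i; rewrite -fsg_classM; apply/class_rel/R1.
- move=> i j; have [->//|ij] := eqVneq i j.
  by rewrite -!fsg_classM; apply/class_rel/R2.
- exact: class_t1.
- exact: class_t_sym.
- move=> i j; have [->|ij] := eqVneq i j; first by rewrite class_t1 mulg1.
  by rewrite (class_tE ij) -fsg_classM; apply/class_rel/R3.
- move=> i j k l; have [->|ij] := eqVneq i j; first by rewrite class_t1 mulg1 mul1g.
  have [->|kl] := eqVneq k l; first by rewrite class_t1 mulg1 mul1g.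
  by rewrite (class_tE ij) (class_tE kl) -!fsg_classM; apply/class_rel/R4.
- have tt i j : class_t i j * class_t i j = class_t i j.
    have [->|ij] := eqVneq i j; first by rewrite class_t1 mulg1.
    by rewrite (class_tE ij) -fsg_classM; apply/class_rel/R3.
  move=> i j k; have [->|ij] := eqVneq i j.
    by rewrite class_t1 mul1g (class_t_sym k) tt.
  have [->|jk] := eqVneq j k; first by rewrite class_t1 mul1g mulg1 class_t_sym.
  have [->|ki] := eqVneq k i; first by rewrite class_t1 mulg1 (class_t_sym j) tt.
  by rewrite (class_tE ij) (class_tE jk) (class_tE ki) -!fsg_classM; apply/class_rel/R5.
- move=> i j k ki kj; have [->|ij] := eqVneq i j; first by rewrite class_t1 mulg1 mul1g.
  rewrite (class_tE ij) -!fsg_classM; apply/class_rel/R6.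
  by rewrite !inE negb_or ki.
- move=> i j ij; rewrite (class_tE ij) -!fsg_classM; apply/class_rel/R7.
  by rewrite !inE eqxx.
- move=> i j ij; rewrite (class_tE ij) -!fsg_classM; apply/class_rel/R8.
  by rewrite !inE eqxx.
- move=> i j k ij jk ki.
  have [ji kj ik] : [/\ j != i, k != j & i != k] by split; rewrite eq_sym.
  rewrite (class_tE ki) (class_tE ij) (class_tE jk) (class_tE kj) (class_tE ji) (class_tE ik).
  by rewrite -!fsg_classM; apply/class_rel/R9.
move=> i j k l ki ij jl lk li jk; have kl : k != l by rewrite eq_sym.
rewrite (class_tE ki) (class_tE ij) (class_tE jl) (class_tE lk) (class_tE kl).
rewrite (class_tE li) (class_tE jk).
by rewrite -!fsg_classM; apply/class_rel/R10.
Qed.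

Lemma class_generator (x : letter n) :
  fsg_class (@rel_R n) (fsg_letter x) = match x with
    | inl i => class_e i | inr p => class_t (sval p).1 (sval p).2 end.
Proof.
case: x => // p; rewrite (class_tE (T_index_neq p)).
congr (fsg_class _ (fsg_letter (inr _))); apply: val_inj => /=.
by case: p => -[i j] /= ->.
Qed.

(** The class of a word depends only on the partition that it represents. *)
Lemma has_normal_form_word (w : fsg (letter n)) :
  has_normal_form class_e class_t (sing_val (phi n w)) (fsg_class (@rel_R n) w).
Proof.
case: w => x s; elim/last_ind: s => [|s y IHs].
  rewrite -[Fsg x _]/(fsg_letter x) class_generator; case: x => [i|p].
    exact: (has_normal_form_e class_relations).
  exact: (has_normal_form_t class_relations (T_index_neq p)).
have -> : Fsg x (rcons s y) = Fsg x s * fsg_letter y by rewrite -cats1.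
rewrite fsg_classM class_generator gmulfM; case: y => [i|p].
  exact: (has_normal_form_mul_e class_relations i IHs).
exact: (has_normal_form_mul_t class_relations _ _ IHs).
Qed.

Lemma phi_rel u v : rel_R u v -> phi n u = phi n v.
Proof.
have H := pmon_relations n; move=> uv.
suff: sing_val (phi n u) = sing_val (phi n v) by apply: val_inj.
have fM w w' : sing_val (phi n (w * w')) = sing_val (phi n w) * sing_val (phi n w').
  by rewrite gmulfM.
have tval i j (ij : i != j) : sing_val (phi n (t_ ij)) = tbar i j by rewrite phi_t.
case: uv.
- by move=> i; apply: (rel_ee H).
- by move=> i j _; apply: (rel_eC H).
- by move=> i j ij; rewrite !fM tval; apply: (rel_tt H).
- by move=> i j k l ij kl; rewrite !fM !tval; apply: (rel_tC H).
- by move=> i j k ij jk ki; rewrite !fM !tval; apply: (rel_t3 H).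
- move=> i j k ij; rewrite !inE negb_or => /andP[ki kj].
  by rewrite !fM !tval; apply: (rel_te H).
- move=> i j k ij; rewrite !inE !fM !tval => /orP[]/eqP->.
    exact: (rel_tet H).
  by rewrite tbarC; apply: (rel_tet H); rewrite eq_sym.
- move=> i j k ij; rewrite !inE !fM !tval => /orP[]/eqP->.
    exact: (rel_ete H).
  by rewrite tbarC; apply: (rel_ete H); rewrite eq_sym.
- move=> i j k ki ij jk *; rewrite !fM !tval; exact: (rel_triangle H).
move=> i j k l *; rewrite !fM !tval; exact: (rel_square H).
Qed.

Lemma phi_congruence u v : congruence_gen (@rel_R n) u v -> phi n u = phi n v.
Proof.
elim=> {u v} [u v /phi_rel|u|u v _ ->|u v w _ -> _ ->|u v u' v' _ uv _ uv'] //.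
by rewrite !gmulfM uv uv'.
Qed.

End Kernel.

Theorem theorem2p1 (n : nat) (hn : 2 <= n) :
  presentation_via (@rel_R n) (phi n).
Proof.
split=> [|u v]; first exact: phi_surjective.
split=> [uv|]; last exact: phi_congruence.
apply/fsg_classP; apply: (has_normal_form_unique (class_relations n)).
  exact: has_normal_form_word.
by rewrite uv; apply: has_normal_form_word.
Qed.
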